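(* Let $k\geq 2$ and $d\geq 1$ be integers, let $x \in \mathbb{R}^d$ and let $S \subset [0,1)^d$ be a semialgebraic set. Suppose that the set of $n \in \mathbb{N}$ such that $\{k^n x\} \in S$ is central. Then the set of $l \in \mathbb{N}$ such that $\{lk^n x\} \in S$ for infinitely many $n \in \mathbb{N}$ is $\mathrm{IP}^*_+$.
   Context: $\{y\}$ is the fractional part, applied coordinatewise. A semialgebraic set is a finite union of sets defined by finitely many polynomial equations $f=0$ and strict inequalities $g>0$. A set $E\subset\mathbb{N}$ is central if there exist a dynamical system $(X,T)$ ($X$ compact metric, $T$ continuous), a pair of proximal points $x,y\in X$ (i.e. $\liminf_n d(T^nx,T^ny)=0$) with $y$ uniformly recurrent, and an open neighbourhood $U$ of $y$ such that $E=\{n: T^n(x)\in U\}$. A set is $\mathrm{IP}$ if it contains all finite nonempty sums of some sequence in $\mathbb{N}$, $\mathrm{IP}^*$ if it meets every $\mathrm{IP}$ set, and $\mathrm{IP}^*_+$ if some translate of it is $\mathrm{IP}^*$. *)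

(* Defs.v *)
From HB Require Import structures.
From mathcomp Require Import all_boot all_order all_algebra finmap.
From mathcomp Require Import all_classical all_reals all_analysis.
(* mpoly is not imported: its notations clash with those of MathComp-Analysis. *)
From mathcomp Require mpoly.

Set Implicit Arguments.
Unset Strict Implicit.
Unset Printing Implicit Defensive.

Import Order.TTheory GRing.Theory Num.Theory.
Import numFieldNormedType.Exports.

Local Open Scope classical_set_scope.
Local Open Scope ring_scope.

(* Throughout, the set N of natural numbers is {1, 2, 3, ...}: subsets of N are
   represented by sets in the type nat, and positivity is written explicitly.
   (With 0 in N, the constant zero sequence would make {0} an IP set.) *)

Definition frac_vec (R : realType) (d : nat) (v : 'rV[R]_d) : 'rV[R]_d :=
  \row_i (v ord0 i - (Num.floor (v ord0 i))%:~R).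

(* The half-open unit cube [0,1)^d. *)
Definition unit_cube (R : realType) (d : nat) : set 'rV[R]_d :=
  [set v | forall i, 0 <= v ord0 i < 1].

Definition basic_semialgebraic (R : realType) (d : nat)
    (fs gs : seq (mpoly.mpoly d R)) : set 'rV[R]_d :=
  [set v | all (fun f => mpoly.meval (v ord0) f == 0) fs /\
           all (fun g => 0 < mpoly.meval (v ord0) g) gs].

Definition semialgebraic (R : realType) (d : nat) (S : set 'rV[R]_d) : Prop :=
  exists (m : nat) (fs gs : 'I_m -> seq (mpoly.mpoly d R)),
    S = \bigcup_(j in [set: 'I_m]) basic_semialgebraic (fs j) (gs j).

Definition proximal (R : realType) (X : metricType R) (T : X -> X) (x y : X) :
    Prop :=
  limn_einf (fun n => (mdist (iter n T x) (iter n T y))%:E) = 0%E.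

(* Bounded gaps: every window of L consecutive integers meets A. *)
Definition syndetic (A : set nat) : Prop :=
  exists L : nat, forall m : nat, exists2 i : nat, (i < L)%N & A (m + i)%N.

Definition uniformly_recurrent (X : topologicalType) (T : X -> X) (y : X) :
    Prop :=
  forall V : set X, nbhs y V -> syndetic [set n | (0 < n)%N /\ V (iter n T y)].

(* The field R is only where the metrics take their values. *)
Definition central (R : realType) (E : set nat) : Prop :=
  exists (X : metricType R) (T : X -> X) (x y : X) (U : set X),
    [/\ compact [set: X] /\ continuous T,
        proximal T x y,
        uniformly_recurrent T y,
        open U /\ U y &
        E = [set n | (0 < n)%N /\ U (iter n T x)]].

Definition IP (A : set nat) : Prop :=
  exists2 u : nat -> nat, (forall i, (0 < u i)%N) &
    forall F : {fset nat}, F != fset0 -> A (\sum_(i <- F) u i)%N.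

Definition IPstar (A : set nat) : Prop :=
  forall B : set nat, IP B -> A `&` B !=set0.

(* The part in N of the translate A + a, where a may be negative. *)
Definition translate (a : int) (A : set nat) : set nat :=
  [set n | (0 < n)%N /\ exists2 m : nat, A m & n%:Z = m%:Z + a].

Definition IPstar_plus (A : set nat) : Prop :=
  exists a : int, IPstar (translate a A).

(* Main.v *)
(* A central set belongs to an idempotent ultrafilter [p]. Write
   {k^n x} = z + ep n with ep n -> 0 along p; idempotency gives vectors dl m -> 0
   with k^m z = z + dl m mod Z^d and ep (m + n) = dl m + k^m ep n for p-many n.
   Hence the ideal of the polynomials vanishing at p-many ep n is stable under the
   expanding homotheties y |-> dl m + k^m y, whose centres tend to 0; this makes it
   invariant under the translations by the span W of the dl m and under all
   dilations. So an equation satisfied by p-many z + ep n holds on z + W + R ep n,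
   and a strict inequality holds at z + w + t ep n for t large and w in W near
   some dl m1. As W is spanned by integer vectors, j z small modulo Z^d means
   j z in W modulo Z^d for small representatives. Take l = k^m1 + j with j z small:
   l k^(m+n) x is congruent to z + w + l dl m + l k^m ep n with w close to dl m1,
   so {l k^N x} is in S for infinitely many N; and {j : j z small} is IP*. *)

Require Import Defs.
From HB Require Import structures.
From mathcomp Require Import all_boot all_order all_algebra finmap.
From mathcomp Require Import all_classical all_reals all_analysis.
From mathcomp Require mpoly.
From mathcomp Require Import ring lra.

Set Implicit Arguments.
Unset Strict Implicit.
Unset Printing Implicit Defensive.

Import Order.TTheory GRing.Theory Num.Theory.
Import numFieldNormedType.Exports.

Local Open Scope classical_set_scope.
Local Open Scope ring_scope.

(** * Idempotent ultrafilters and central sets *)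

(* The product of the semigroup [beta N] of ultrafilters, extended to filters:
   an ultrafilter is idempotent when [p `<=` filter_conv p p]. *)
Definition filter_conv (F G : set_system nat) : set_system nat :=
  [set A | F [set m | G [set n | A (m + n)%N]]].

(* The Ellis-Numakura argument, with the filters [F `<=` F * F] in the role of the
   closed subsemigroups of [beta N] and Zorn's lemma giving a maximal one. *)
Lemma idempotent_ultrafilter (F0 : set_system nat) :
  ProperFilter F0 -> F0 `<=` filter_conv F0 F0 ->
  exists p : set_system nat,
    [/\ UltraFilter p, F0 `<=` p & p `<=` filter_conv p p].
Proof.
move=> F0P F0idem.
pose good (F : set_system nat) :=
  [/\ ProperFilter F, F0 `<=` F & F `<=` filter_conv F F].
have [F [[FP F0F Fidem] Fmax]] : exists F, good F /\
    forall G, good G -> F `<=` G -> G = F.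
  have [C Ctot|F [gF Fmax]] := @Zorn_bigcup _
      [set F : set (set nat) | F = set0 \/ good F]; last first.
    have gF0 : good F0 by split.
    case: gF => [F_0|gF].
      exists F0; split => // G gG F0G; exfalso.
      apply: (Fmax G); last by right.
      rewrite F_0; split; first exact: sub0set.
      by case: gG => GP _ _ /(_ _ (@filterT _ _ GP)).
    exists F; split => // G gG FG; apply: contrapT => GF.
    apply: (Fmax G); last by right.
    split => // GF'; apply: GF; apply/seteqP; split=> //.
  move=> CS.
  have [[F CF gF]|nog] := pselect (exists2 F, C F & good F); last first.
    left; apply/seteqP; split=> // A [F CF FA].
    by have [F_0|gF] := Ctot _ CF; [rewrite F_0 in FA|case: nog; exists F].
  right.
  have big F1 F2 A B : C F1 -> C F2 -> F1 A -> F2 B ->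
      exists F3, [/\ C F3, good F3, F1 `<=` F3 & F2 `<=` F3].
    move=> C1 C2 A1 B2.
    have gd F' A' : C F' -> F' A' -> good F'.
      by move=> /Ctot[->|].
    by have [s|s] := CS _ _ C1 C2; [exists F2|exists F1]; split=> //;
      [exact: gd B2|exact: gd A1].
  have [FP F0F Fi] := gF.
  split.
  - apply: Build_ProperFilter_ex.
      move=> A [G CG GA].
      have [G3 [_ [G3P _ _] sG _]] := big _ _ _ _ CG CG GA GA.
      exact: filter_ex (sG _ GA).
    split.
    + by exists F => //; exact: filterT.
    + move=> A B [G1 C1 A1] [G2 C2 B2].
      have [G3 [CG3 [G3P _ _] s1 s2]] := big _ _ _ _ C1 C2 A1 B2.
      by exists G3 => //; apply: filterI; [exact: s1|exact: s2].
    + move=> A B AB [G1 C1 A1].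
      have [G3 [CG3 [G3P _ _] s1 _]] := big _ _ _ _ C1 C1 A1 A1.
      by exists G3 => //; apply: (filterS AB); exact: s1.
  - by move=> A F0A; exists F => //; exact: F0F.
  - move=> A [G1 C1 A1].
    have [G3 [CG3 [G3P _ G3i] s1 _]] := big _ _ _ _ C1 C1 A1 A1.
    have := G3i _ (s1 _ A1).
    move=> GA; exists G3 => //.
    move: GA; rewrite /filter_conv /=; apply: filterS => m Gm.
    by exists G3.
have [q [qU Fq]] := ultraFilterLemma FP.
(* The product of [F] with an ultrafilter [q] refining it is again good and contains [F], hence
   equals [F] by maximality. *)
pose Fq' : set_system nat := filter_conv F q.
have Fq'E : Fq' = F.
  apply: Fmax.
  - split.
    + apply: Build_ProperFilter_ex.
        move=> A FA; have [m qm] := @filter_ex _ F _ _ FA.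
        by have [n Amn] := @filter_ex _ q _ _ qm; exists (m + n)%N.
      rewrite /Fq' /filter_conv; split.
      * by rewrite /=; apply: filterS filterT => m _; exact: filterT.
      * by move=> A B /= FA FB; apply: filterS (filterI FA FB) => m [/= ? ?];
          exact: filterI.
      * by move=> A B AB /=; apply: filterS => m; apply: filterS => n; exact: AB.
    + move=> A /F0F/Fidem; rewrite /Fq' /filter_conv /=.
      by apply: filterS => m; exact: Fq.
    + move=> A /Fidem; rewrite /filter_conv /Fq' /=.
      apply: filterS => m /Fidem; rewrite /filter_conv /= => Fm.
      apply: Fq; apply: filterS Fm => n Fn.
      apply: filterS (Fn) => r; rewrite /= => qr.
      by apply: filterS qr => s; rewrite /= !addnA.
  - move=> A /Fidem; rewrite /Fq' /filter_conv /=.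
    by apply: filterS => m; exact: Fq.
(* The filter [G] generated by [F] and the sets [B A] with [A] in [q] is good, hence equals [F]. So
   [B A] lies in [F], thus in [q]: this is the idempotency of [q]. *)
pose B (A : set nat) := [set m | q [set n | A (m + n)%N]].
pose G : set_system nat :=
  [set D | exists2 A, q A & exists2 E, F E & B A `&` E `<=` D].
have BI A A' : B (A `&` A') = B A `&` B A'.
  apply/seteqP; split=> [m qm|m [/= qm qm']]; last exact: filterI.
  by split; apply: filterS qm => n [].
have FG : F `<=` G.
  move=> E FE; exists setT; first exact: filterT.
  by exists E => // m [].
have BG A : q A -> G (B A).
  by move=> qA; exists A => //; exists setT; [exact: filterT|move=> m []].
have GS D D' : D `<=` D' -> G D -> G D'.
  move=> DD' [A qA [E FE sD]].
  by exists A => //; exists E => // m /sD/DD'.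
have GI D D' : G D -> G D' -> G (D `&` D').
  move=> [A qA [E FE sD]] [A' qA' [E' FE' sD']].
  exists (A `&` A'); first exact: filterI.
  exists (E `&` E'); first exact: filterI.
  rewrite BI => m [[? ?] [? ?]].
  by split; [exact: sD|exact: sD'].
have GF : G = F.
  apply: Fmax => //; split.
  - apply: Build_ProperFilter_ex; last first.
      by split=> //; apply: FG; exact: filterT.
    move=> D [A qA [E FE sD]].
    suff [m [Bm Em]] : B A `&` E !=set0 by exists m; apply: sD.
    apply: contrapT => H.
    (* If [B A] missed [E], the translates of the complement of [A] by the elements of [E] would be
       in [q], which puts this complement in [Fq' = F]. *)
    suff qnA : q (~` A) by have [? []] := filter_ex (filterI qA qnA).
    apply: Fq; rewrite -Fq'E; apply: filterS FE => m Em.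
    have [qm|//] := in_ultra_setVsetC [set n | A (m + n)%N] qU.
    by case: H; exists m; split.
  - by move=> A /F0F/FG.
  - move=> D [A qA [E FE sD]].
    have H1 : G [set m | F [set n | E (m + n)%N]] by apply: FG; exact: Fidem.
    apply: GS (GI _ _ (BG _ qA) H1) => m [Bm /= Em].
    exists [set n | A (m + n)%N] => //.
    exists [set n | E (m + n)%N] => // n [Bn En].
    apply: sD; split => //; apply: filterS Bn => r /=.
    by rewrite addnA.
exists q; split => //.
- by move=> A /F0F/Fq.
- move=> A qA; apply: Fq; rewrite -GF; exact: BG.
Qed.

Lemma proximal_frequently_close (R : realType) (X : metricType R) (T : X -> X)
    (x y : X) (N : nat) (e : R) : proximal T x y -> 0 < e ->
  exists2 n, (N <= n)%N & mdist (iter n T x) (iter n T y) < e.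
Proof.
move=> prox e0; set u := fun n => (mdist (iter n T x) (iter n T y))%:E : \bar R.
have uN : (einfs u N <= 0)%E.
  rewrite -[leRHS]prox limn_einf_lim (cvg_lim _ (@cvg_einfs_sup _ u))//.
  by apply: ereal_sup_ubound; exists N.
have : (ereal_inf (sdrop u N) < e%:E)%E.
  by apply: le_lt_trans uN _; rewrite lte_fin.
by case/ereal_inf_lt => _ [n /= Nn <-]; rewrite lte_fin; exists n.
Qed.

Lemma continuous_iter (X : topologicalType) (T : X -> X) (n : nat) :
  continuous T -> continuous (iter n T).
Proof.
move=> Tc; elim: n => [|n IH] z; first exact: cvg_id.
by apply: (@continuous_comp _ _ _ (iter n T) T); [exact: IH|exact: Tc].
Qed.

(* Clustering the pairs of close points in the compact space gives a point near
   which [T] is equicontinuous on the window. *)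
Lemma proximal_window (R : realType) (X : metricType R) (T : X -> X)
    (x y : X) (N L : nat) (e : R) :
  compact [set: X] -> continuous T -> proximal T x y -> 0 < e ->
  exists2 n, (N <= n)%N & forall i, (i < L)%N ->
    mdist (iter (n + i) T x) (iter (n + i) T y) < e.
Proof.
move=> Xco Tc prox e0.
pose D r := [set n | (N <= n)%N /\ mdist (iter n T x) (iter n T y) < r].
have FP : ProperFilter (filter_from [set r : R | 0 < r] D).
  apply: filter_from_proper; last first.
    move=> r r0; have [n Nn nr] := proximal_frequently_close N prox r0.
    by exists n.
  apply: filter_from_filter; first by exists 1 => /=.
  move=> r s /= r0 s0; exists (Num.min r s) => /=; first by rewrite lt_min r0.
  by move=> n [Nn]; rewrite lt_min => /andP[? ?].
have [a [_ acl]] := Xco _ (fmap_proper_filter (fun n => iter n T y) FP) filterT.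
have e2 : 0 < e / 2 by rewrite divr_gt0.
have : \forall u \near a, forall i : 'I_L, ball (iter i T a) (e / 2) (iter i T u).
  apply: filter_forall => i.
  by apply: (@continuous_iter _ T i Tc a); exact: nbhsx_ballx.
move=> /nbhs_ballP[r /= r0 Hr].
have r2 : 0 < r / 2 by rewrite divr_gt0.
have [_ [[n [Nn nr] <-] ny]] : ([set iter n T y | n in D (r / 2)] `&`
    ball a (r / 2)) !=set0.
  apply: acl; last exact: nbhsx_ballx.
  by exists (r / 2) => // n Dn; exists n.
exists n => // i iL; rewrite ![(n + i)%N]addnC !iterD.
have r2r : r / 2 <= r by rewrite ler_pdivrMr// ler_pMr// ler1n.
have ny' := Hr _ (le_ball r2r ny).
have nx : ball a r (iter n T x).
  rewrite (splitr r); apply: ball_triangle ny _.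
  by rewrite ballEmdist /= metric_sym.
move: (Hr _ nx (Ordinal iL)) (ny' (Ordinal iL)) => /=.
rewrite !ballEmdist /= => h1 h2.
rewrite (splitr e) (le_lt_trans (metric_triangle _ (iter i T a) _))// ltrD//.
by rewrite metric_sym.
Qed.

(** The filter is generated by the times at which both orbits are in a given neighbourhood of [y].
    Following [y] as well makes it stable under the product. It is proper because the orbits stay
    close during a window longer than the return gaps of [y]. *)
Lemma central_idempotent (R : realType) (E : set nat) : central R E ->
  exists p : set_system nat, [/\ UltraFilter p, p `<=` filter_conv p p, p E &
    forall N : nat, p [set n | (N <= n)%N]].
Proof.
move=> [X [T [x [y [U [[Xco Tc] prox urec [Uo Uy] ->]]]]]].
pose W (i : set X * nat) := [set n | [/\ (i.2 <= n)%N, i.1 (iter n T x) &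
  i.1 (iter n T y)]].
pose D : set (set X * nat) := [set i | nbhs y i.1].
have F0P : ProperFilter (filter_from D W).
  apply: filter_from_proper.
    apply: filter_from_filter; first by exists (setT, 0%N); exact: filterT.
    move=> [V N] [V' N'] /= yV yV'; exists (V `&` V', maxn N N').
      exact: filterI.
    by move=> n /= [/=]; rewrite geq_max => /andP[? ?] [? ?] [? ?].
  move=> [V N] /= yV.
  have [e /= e0 eV] : exists2 e : R, 0 < e & ball y e `<=` V.
    by move: yV => /nbhs_ballP[e /= e0 ?]; exists e.
  have e2 : 0 < e / 2 by rewrite divr_gt0.
  have [L HL] := urec _ (nbhsx_ballx y _ e2).
  have [n Nn nclose] := proximal_window N L Xco Tc prox e2.
  have [i iL [ni Bi]] := HL n.
  exists (n + i)%N; split; first exact: leq_trans Nn (leq_addr _ _).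
  - apply: eV; rewrite (splitr e); apply: ball_triangle Bi _.
    by rewrite ballEmdist /= metric_sym; exact: nclose.
  - apply: eV; apply: le_ball Bi.
    by rewrite ler_pdivrMr// ler_pMr// ler1n.
have [A [[V N] /= yV sVA]|p [pU F0p pidem]] := idempotent_ultrafilter F0P.
  (* When T^m y is in the interior of [V], the preimage of [V] under T^m is a neighbourhood of
     [y]. *)
  exists ((fun u => V° u), N); first exact: nbhs_interior.
  move=> m [/= Nm _ Vm]; exists (iter m T @^-1` V, N) => /=.
    by apply: (@continuous_iter _ T m Tc y); exact: Vm.
  move=> n [/= Nn nx ny]; apply: sVA; split => /=.
  - exact: leq_trans Nn (leq_addl _ _).
  - by rewrite iterD.
  - by rewrite iterD.
exists p; split => //.
- apply: F0p; exists (U, 1%N); first exact: open_nbhs_nbhs.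
  by move=> n [].
- move=> N; apply: F0p; exists (setT, N); first exact: filterT.
  by move=> n [].
Qed.

(** * Expansion of the orbit along an idempotent ultrafilter *)

(** The homothety y |-> dl m + k^m y sends [ep n] to [ep (m + n)]. For [ep = dl] this says that the
    homotheties of [m] and [n] compose to that of [m + n]. *)
Definition scaling_cocycle (R : realType) (d : nat) (p : set_system nat)
    (k : nat) (dl ep : nat -> 'rV[R]_d) : Prop :=
  forall m, \forall n \near p, ep (m + n)%N = dl m + (k ^ m)%:R *: ep n.

Definition int_vec (R : realType) (d : nat) (v : 'rV[R]_d) : Prop :=
  forall i, v ord0 i \is a Num.int.

Lemma int_vecD (R : realType) (d : nat) (u v : 'rV[R]_d) :
  int_vec u -> int_vec v -> int_vec (u + v).
Proof. by move=> hu hv i; rewrite mxE rpredD. Qed.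

Lemma int_vecB (R : realType) (d : nat) (u v : 'rV[R]_d) :
  int_vec u -> int_vec v -> int_vec (u - v).
Proof. by move=> hu hv i; rewrite !mxE rpredB. Qed.

Lemma int_vecZ (R : realType) (d : nat) (a : R) (v : 'rV[R]_d) :
  a \is a Num.int -> int_vec v -> int_vec (a *: v).
Proof. by move=> ha hv i; rewrite !mxE rpredM. Qed.

Lemma norm_coord_le (R : realType) (d : nat) (v : 'rV[R]_d) (i : 'I_d) :
  `|v ord0 i| <= `|v|.
Proof.
rewrite [leRHS]/Num.norm /= mx_normrE.
exact: (@le_bigmax _ R _ 0 (fun ij : 'I_1 * 'I_d => `|v ij.1 ij.2|) (ord0, i)).
Qed.

Lemma int_vec_eq (R : realType) (d : nat) (u v : 'rV[R]_d) :
  int_vec (u - v) -> (forall i, `|u ord0 i - v ord0 i| < 1) -> u = v.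
Proof.
move=> uv uv1; apply/rowP => i; apply/eqP; rewrite -subr_eq0.
apply: contraTT (uv1 i) => v0.
by rewrite -leNgt norm_intr_ge1//; have := uv i; rewrite !mxE.
Qed.

Lemma ultra_fmap (I T : Type) (p : set_system I) (f : I -> T) :
  UltraFilter p -> UltraFilter (f @ p).
Proof.
move=> pU; split; first exact: fmap_proper_filter.
move=> G GP fG; apply/seteqP; split; last exact: fG.
move=> A GA; have [//|pC] := in_ultra_setVsetC (f @^-1` A) pU.
have /fG GC : (f @ p) (~` A) by [].
by have [? []] := filter_ex (filterI GA GC).
Qed.

Lemma ultra_compact_cvg (I : Type) (T : topologicalType) (p : set_system I)
    (A : set T) (u : I -> T) : UltraFilter p -> compact A ->
  (\forall n \near p, A (u n)) -> exists2 l, A l & u @ p --> l.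
Proof.
move=> pU; rewrite compact_ultra => Aco Au.
have [l [Al ul]] := Aco _ (ultra_fmap u pU) Au.
by exists l.
Qed.

Lemma ultra_exists (I : Type) (J : finType) (p : set_system I)
    (P : J -> set I) : UltraFilter p ->
  (\forall n \near p, exists j, P j n) -> exists j, p (P j).
Proof.
move=> pU H; apply: contrapT => /forallNP nP.
have nH : \forall n \near p, forall j, ~ P j n.
  apply: filter_forall => j.
  by have [/nP|] := in_ultra_setVsetC (P j) pU.
have [n [[j Pj] nPj]] := filter_ex (filterI H nH).
exact: nPj Pj.
Qed.

(** Integer vectors within 1/2 of the limit differ by less than 1 in each coordinate, so they
    coincide. *)
Lemma cvg_int_vec (R : realType) (d : nat) (p : set_system nat)
    (u : nat -> 'rV[R]_d) (l : 'rV[R]_d) : ProperFilter p ->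
  (forall n, int_vec (u n)) -> u @ p --> l ->
  int_vec l /\ \forall n \near p, u n = l.
Proof.
move=> pP uint ul.
have half : (0 : R) < 1 / 2 by rewrite divr_gt0.
have Hl : \forall n \near p, `|l - u n| < 1 / 2 by move/cvgrPdist_lt: ul; exact.
have [n0 Hn0] := filter_ex Hl.
have un0 : \forall n \near p, u n = u n0.
  apply: filterS Hl => n Hn; apply: int_vec_eq; first exact: int_vecB.
  move=> i; rewrite (_ : _ - _ = (l - u n0) ord0 i - (l - u n) ord0 i); last first.
    by rewrite !mxE; ring.
  rewrite (splitr 1) (le_lt_trans (ler_normB _ _))// ltrD//.
    exact: le_lt_trans (norm_coord_le _ _) Hn0.
  exact: le_lt_trans (norm_coord_le _ _) Hn.
have -> // : l = u n0.
apply: (@cvg_unique _ (@norm_hausdorff _ _) _ _ _ _ ul).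
apply: (@cvg_trans _ (cst (u n0) @ p)); last exact: cvg_cst.
by apply: near_eq_cvg; apply: filterS un0 => n /= ->.
Qed.

Lemma frac_vecB (R : realType) (d : nat) (v : 'rV[R]_d) :
  int_vec (v - frac_vec v).
Proof. by move=> i; rewrite !mxE subKr intr_int. Qed.

Lemma frac_vec_cube (R : realType) (d : nat) (v : 'rV[R]_d) :
  unit_cube (frac_vec v).
Proof.
move=> i; have /andP[h1 h2] := floor_itv (v ord0 i).
by rewrite intrD in h2; rewrite mxE; apply/andP; split; lra.
Qed.

Lemma frac_vec_unique (R : realType) (d : nat) (v y : 'rV[R]_d) :
  unit_cube y -> int_vec (v - y) -> frac_vec v = y.
Proof.
move=> cy vy; apply: int_vec_eq.
  rewrite (_ : _ - y = (v - y) - (v - frac_vec v)).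
    by apply: int_vecB => //; exact: frac_vecB.
  by apply/rowP => j; rewrite !mxE; ring.
move=> i; have /andP[h1 h2] := frac_vec_cube v i.
have /andP[h3 h4] := cy i.
by rewrite ltr_norml; apply/andP; split; lra.
Qed.

Lemma cvg_norm_le_near (R : realType) (d : nat) (p : set_system nat)
    (u : nat -> 'rV[R]_d) (l : 'rV[R]_d) (e : R) : ProperFilter p ->
  u @ p --> l -> (\forall n \near p, `|u n| <= e) -> `|l| <= e.
Proof.
move=> pP ul ue; apply/ler_addgt0Pr => r r0.
have Hr : \forall n \near p, `|l - u n| < r by move/cvgrPdist_lt: ul; exact.
have [n [ne nr]] := filter_ex (filterI ue Hr).
rewrite -(subrK (u n) l) (le_trans (ler_normD _ _))// addrC lerD//.
exact: ltW.
Qed.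

(** Here [z] is the limit of {k^n x} along [p], and [dl m] is the limit in [n] of [ep (m + n)]. *)
Lemma idempotent_expansion (R : realType) (k d : nat) (x : 'rV[R]_d)
    (p : set_system nat) : UltraFilter p -> p `<=` filter_conv p p ->
  exists (z : 'rV[R]_d) (dl ep : nat -> 'rV[R]_d),
  [/\ dl @ p --> (0 : 'rV[R]_d) /\ ep @ p --> (0 : 'rV[R]_d),
     scaling_cocycle p k dl dl, scaling_cocycle p k dl ep,
     (forall n, frac_vec ((k ^ n)%:R *: x) = z + ep n) &
     (forall m, int_vec ((k ^ m)%:R *: z - z - dl m))].
Proof.
move=> pU pidem.
pose u n := frac_vec ((k ^ n)%:R *: x).
have Cco : compact [set v : 'rV[R]_d | forall i, `[0, 1]%classic (v ord0 i)].
  exact: (@rV_compact R d (fun=> `[0, 1]%classic) (fun=> @segment_compact R 0 1)).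
have uC n : [set v : 'rV[R]_d | forall i, `[0, 1]%classic (v ord0 i)] (u n).
  move=> i; rewrite /= in_itv /=.
  by have /andP[-> /ltW] := frac_vec_cube ((k ^ n)%:R *: x) i.
have lim s : exists l : 'rV[R]_d, (fun n => u (s + n)%N) @ p --> l.
  have [//|l _ ul] := ultra_compact_cvg (u := fun n => u (s + n)%N) pU Cco.
    by apply: filterS filterT => n _; exact: uC.
  by exists l.
have [z uz] := lim 0%N.
have [y uy] := choice lim.
pose ep n := u n - z; pose dl m := y m - z.
have epdl m : (fun n => ep (m + n)%N) @ p --> dl m.
  by apply: cvgB; [exact: uy|exact: cvg_cst].
have ep0 : ep @ p --> (0 : 'rV[R]_d).
  by rewrite -[X in _ --> X](subrr z); apply: cvgB => //; exact: cvg_cst.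
have key m : int_vec ((k ^ m)%:R *: z - z - dl m) /\
    \forall n \near p, ep (m + n)%N = dl m + (k ^ m)%:R *: ep n.
  (* These integer vectors converge, so they equal their limit for p-many [n]; this gives both the
     congruence for [z] and the cocycle relation. *)
  have [||I1 I2] := @cvg_int_vec _ _ p (fun n => (k ^ m)%:R *: u n - u (m + n)%N)
     ((k ^ m)%:R *: z - y m).
  - move=> n.
    rewrite (_ : _ - _ = ((k ^ (m + n))%:R *: x - u (m + n)%N) -
       (k ^ m)%:R *: ((k ^ n)%:R *: x - u n)).
      apply: int_vecB; first exact: frac_vecB.
      by apply: int_vecZ; [exact: rpred_nat|exact: frac_vecB].
    by apply/rowP => i; rewrite !mxE expnD natrM; ring.
  - by apply: cvgB; [apply: cvgZl_tmp|exact: uy].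
  split; first by rewrite /dl opprB addrA subrK.
  apply: filterS I2 => n /= I2.
  rewrite /ep /dl; apply/eqP; rewrite -subr_eq0; apply/eqP.
  transitivity (((k ^ m)%:R *: z - y m) - ((k ^ m)%:R *: u n - u (m + n)%N)).
    by apply/rowP => i; rewrite !mxE; ring.
  by rewrite I2 subrr.
exists z, dl, ep; split.
- split => //; apply/cvgrPdist_lt => e e0.
  have e2 : 0 < e / 2 by rewrite divr_gt0.
  have : \forall n \near p, `|0 - ep n| < e / 2 by move/cvgrPdist_lt: ep0; exact.
  (* By idempotency [ep (m + n)] is small for p-many [n], hence so is its limit [dl m]. The half
     absorbs the loss of strictness in the limit. *)
  move=> /pidem; rewrite /filter_conv /=; apply: filterS => m Hm.
  rewrite sub0r normrN; apply: (@le_lt_trans _ _ (e / 2)); last first.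
    by rewrite ltr_pdivrMr// ltr_pMr// ltr1n.
  apply: (cvg_norm_le_near _ (epdl m)); apply: filterS Hm => n /=.
  by rewrite sub0r normrN => /ltW.
(* The vector [ep (m + n + r)] is expanded in two ways and the common term in [ep r] is
   cancelled. *)
- move=> m; have [_ Hm] := key m.
  move: (Hm) => /pidem; rewrite /filter_conv /=; apply: filterS => n Hmn.
  have [_ Hn] := key n; have [_ Hmn'] := key (m + n)%N.
  have [r [[/= h1 h2] h3]] := filter_ex (filterI (filterI Hmn Hn) Hmn').
  move: h1; rewrite addnA h3 h2 [(k ^ m)%:R *: (_ + _)]scalerDr scalerA.
  rewrite -natrM -expnD addrA.
  by move/addIr.
- by move=> m; have [] := key m.
- by move=> n; rewrite /ep addrC subrK.
- by move=> m; have [] := key m.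
Qed.

(** * Rationality of the span of the displacements *)

(** Among the matrices with row space inside [P], one of maximal rank absorbs every vector of
    [P]. *)
Lemma subspace_rowspace (F : fieldType) (n : nat) (P : 'rV[F]_n -> Prop) :
  P 0 -> (forall a u v, P u -> P v -> P (a *: u + v)) ->
  exists M : 'M[F]_n, forall v, P v <-> (v <= M)%MS.
Proof.
move=> P0 PL.
pose good r := `[< exists2 M : 'M[F]_n, forall v, (v <= M)%MS -> P v & \rank M = r >].
have good0 : exists r, good r.
  exists 0%N; apply/asboolP; exists 0; last exact: mxrank0.
  by move=> v; rewrite submx0 => /eqP ->.
have goodn r : good r -> (r <= n)%N by move=> /asboolP[M _ <-]; exact: rank_leq_row.
case: (ex_maxnP good0 goodn) => r /asboolP[M MP Mr] rmax.
exists M => v; split; last exact: MP.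
move=> Pv; have : good (\rank (M + v)%MS).
  apply/asboolP; exists (M + v)%MS => // w /sub_addsmxP[[a b] ->] /=.
  rewrite [b]mx11_scalar mul_scalar_mx addrC; apply: PL => //.
  exact/MP/submxMl.
move=> /rmax; rewrite -Mr => rle.
have := mxrank_leqif_sup (addsmxSl M v).
move=> /geq_leqif; rewrite rle => /esym.
by apply: submx_trans; exact: addsmxSr.
Qed.

Lemma cvg_rsum (R : realType) (I J : Type) (p : set_system I) (s : seq J)
    (P : pred J) (u : J -> I -> R) (l : J -> R) : Filter p ->
  (forall j, u j @ p --> l j) ->
  (fun n => \sum_(j <- s | P j) u j n) @ p --> \sum_(j <- s | P j) l j.
Proof.
by move=> pF ul; apply: cvg_big => [|j _]; [exact: add_continuous|exact: ul].
Qed.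

Lemma cvg_expn_inv (R : realType) (k : nat) (p : set_system nat) (b : R) :
  Filter p -> (2 <= k)%N -> (forall N, p [set n | (N <= n)%N]) ->
  (fun m => ((k ^ m)%:R - b)^-1 : R) @ p --> (0 : R).
Proof.
move=> pF k2 ptail; apply/cvgr0Pnorm_lt => e e0.
have ei0 : 0 < e^-1 by rewrite invr_gt0.
have e1 : 0 <= e^-1 + `|b| by rewrite addr_ge0 // ltW.
apply: filterS (ptail (Num.bound (e^-1 + `|b|))) => m /= mN.
have km : e^-1 + `|b| < (k ^ m)%:R :> R.
  apply: lt_le_trans (archi_boundP e1) _.
  by rewrite ler_nat (leq_trans mN) // ltnW // ltn_expl.
have km0 : e^-1 < (k ^ m)%:R - b.
  by rewrite ltrBrDr (le_lt_trans _ km)// lerD2l ler_norm.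
have k0 := lt_trans ei0 km0.
rewrite ger0_norm ?invr_ge0 ?ltW //.
by rewrite -[X in _ < X]invrK ltf_pV2 // posrE.
Qed.

(** A row space is the kernel of a continuous linear map, hence closed. *)
Lemma cvg_rowspace (R : realType) (I : Type) (d m : nat) (p : set_system I)
    (M : 'M[R]_(m, d)) (u : I -> 'rV[R]_d) (l : 'rV[R]_d) : ProperFilter p ->
  u @ p --> l -> (\forall n \near p, (u n <= M)%MS) -> (l <= M)%MS.
Proof.
move=> pP ul uM; rewrite submxE; apply/eqP/rowP => j; rewrite [RHS]mxE.
have coord i : (fun n => u n ord0 i) @ p --> l ord0 i.
  have := @coord_continuous R 1 d ord0 i l.
  exact: (@cvg_comp _ _ _ u (fun v : 'rV[R]_d => v ord0 i)).
have h : (fun n => (u n *m cokermx M) ord0 j) @ p --> (l *m cokermx M) ord0 j.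
  rewrite [X in _ --> X]mxE; under eq_fun do rewrite mxE.
  apply: (@cvg_rsum _ _ _ _ _ _ (fun i n => u n ord0 i * cokermx M i j)) => i.
  by apply: cvgMr_tmp.
apply: (@cvg_unique _ (@Rhausdorff _) _ _ _ _ h).
apply: (@cvg_trans _ (cst 0 @ p)); last exact: cvg_cst.
apply: near_eq_cvg; apply: filterS uM => n.
by rewrite submxE => /eqP -> /=; rewrite mxE.
Qed.

Lemma rat_matrix_denom (m n : nat) (K : 'M[rat]_(m, n)) :
  exists2 D : nat, (0 < D)%N & forall i j, D%:R * K i j \is a Num.int.
Proof.
pose D := (\prod_(ij : 'I_m * 'I_n) `|denq (K ij.1 ij.2)|)%N.
exists D; first by rewrite prodn_gt0 // => ij; rewrite absz_gt0 denq_neq0.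
move=> i j; have := divq_num_den (K i j); set a := K i j => <-.
rewrite /D (bigD1 (i, j)) //= natrM mulrC mulrA.
rewrite (_ : `|denq (K i j)|%:R = (denq a)%:~R); last first.
  by rewrite -[RHS](@ger0_norm _ (denq a)%:~R) ?ler0z ?denq_ge0// -intr_norm -abszE.
rewrite -[_ / _ * _]mulrA mulVf ?mulr1 ?intr_eq0 ?denq_neq0//.
by rewrite rpredM ?intr_int ?rpred_nat.
Qed.

Lemma int_vec_rat (R : realType) (d : nat) (v : 'rV[R]_d) : int_vec v ->
  exists q : 'rV[rat]_d, map_mx ratr q = v.
Proof.
move=> vint; exists (\row_i (Num.floor (v ord0 i))%:~R).
by apply/rowP => i; rewrite !mxE ratr_int floorK.
Qed.

(* The span [W] of the [dl m] is generated by integer vectors, on which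
   [z] is rational: hence a small representative of [j z] modulo [Z^d] has to
   belong to [W]. *)
Lemma small_multiple_in_span (R : realType) (k d : nat) (p : set_system nat)
    (z : 'rV[R]_d) (dl : nat -> 'rV[R]_d) (A : set nat) (W : 'M[R]_d) :
  (2 <= k)%N -> ProperFilter p -> (forall N, p [set n | (N <= n)%N]) -> p A ->
  dl @ p --> (0 : 'rV[R]_d) ->
  (forall m, int_vec ((k ^ m)%:R *: z - z - dl m)) ->
  (forall m, A m -> (dl m <= W)%MS) ->
  (forall M : 'M[R]_d, (forall m, A m -> (dl m <= M)%MS) -> (W <= M)%MS) ->
  exists2 e : R, 0 < e & forall (j : nat) (eta : 'rV[R]_d),
    int_vec (j%:R *: z - eta) -> `|eta| < e -> (eta <= W)%MS.
Proof.
move=> k2 pP ptail pA dl0 vint dlW Wmin.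
pose v m := (k ^ m)%:R *: z - z - dl m.
(* The row space of [M] consists of the rational vectors of [W]; their real span [MR] will be shown
   to contain the [dl m]. *)
have [M HM] : exists M : 'M[rat]_d, forall q : 'rV[rat]_d,
    (map_mx ratr q <= W)%MS <-> (q <= M)%MS.
  apply: subspace_rowspace; first by rewrite map_mx0 sub0mx.
  move=> a q r hq hr; rewrite map_mxD map_mxZ addmx_sub// scalemx_sub//.
pose MR : 'M[R]_d := map_mx ratr M.
have kcvg := @cvg_expn_inv R k p 1 filter_filter k2 ptail.
have intMR u : int_vec u -> (u <= W)%MS -> (u <= MR)%MS.
  move=> /int_vec_rat[q <-] /HM qM; rewrite /MR.
  by rewrite map_submx.
have dlMR m0 : A m0 -> (dl m0 <= MR)%MS.
  move=> Am0.
  (* Eliminating [z] between [v m] and [v m0] leaves an integer vector of [W]; divided by k^m - 1,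
     it tends to [dl m0]. *)
  have h : (fun m => dl m0 - (((k ^ m)%:R - 1)^-1 * ((k ^ m0)%:R - 1)) *: dl m)
      @ p --> dl m0.
    rewrite -[X in _ --> X]subr0; apply: cvgB; first exact: cvg_cst.
    rewrite -[X in _ --> X](scaler0 _ (0 * ((k ^ m0)%:R - 1))).
    apply: cvgZ; last exact: dl0.
    apply: cvgMr_tmp; exact: kcvg.
  apply: (cvg_rowspace _ h).
  apply: filterS (filterI pA (ptail 1%N)) => m [Am m1].
  have k1 : (k ^ m)%:R - 1 != 0 :> R.
    by rewrite subr_eq0 -[1]/(1%:R) eqr_nat -[X in _ != X](expn0 k) eqn_exp2l// -lt0n.
  rewrite (_ : _ - _ = ((k ^ m)%:R - 1)^-1 *:
     (((k ^ m0)%:R - 1) *: v m - ((k ^ m)%:R - 1) *: v m0)); last first.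
    by apply/rowP => i; rewrite /v !mxE; field.
  apply/scalemx_sub/intMR.
    apply: int_vecB; apply: int_vecZ; try exact: vint;
      by rewrite rpredB ?rpred_nat ?rpred1.
  rewrite (_ : _ - _ = ((k ^ m)%:R - 1) *: dl m0 - ((k ^ m0)%:R - 1) *: dl m).
    by apply: addmx_sub; rewrite ?eqmx_opp; apply: scalemx_sub; exact: dlW.
  by apply/rowP => i; rewrite /v !mxE; ring.
have MRW : (MR <= W)%MS.
  apply/row_subP => i; rewrite /MR -map_row; apply/HM; exact: row_sub.
have [D D0 Dint] := rat_matrix_denom (cokermx M).
(* An integer matrix whose left kernel is the row space of [MR]. *)
pose KR : 'M[R]_d := \matrix_(i, j) ratr (D%:R * cokermx M i j).
have KRE : KR = D%:R *: cokermx MR.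
  apply/matrixP => i j; rewrite /MR -map_cokermx !mxE.
  by rewrite rmorphM /= ratr_nat.
have [m0 [Am0 m01]] := filter_ex (filterI pA (ptail 1%N)).
pose c : R := (k ^ m0)%:R - 1.
have c0 : 0 < c.
  by rewrite subr_gt0 -[1]/(1%:R) ltr_nat -[X in (X < _)%N](expn0 k) ltn_exp2l.
pose B := \sum_i \sum_j `|KR i j|.
have B0 : 0 <= B by apply: sumr_ge0 => i _; apply: sumr_ge0.
exists (c * B + 1)^-1; first by rewrite invr_gt0 ltr_wpDl// mulr_ge0 // ltW.
move=> j eta jint eta_small.
apply: (submx_trans _ MRW); rewrite submxE.
suff : c *: (eta *m KR) = 0.
  move/eqP; rewrite scaler_eq0 gt_eqF //= KRE -scalemxAr scaler_eq0.
  by rewrite pnatr_eq0 gtn_eqF.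
have KRint a b : KR a b \is a Num.int.
  by rewrite mxE; have /intrP[q ->] := Dint a b; rewrite ratr_int intr_int.
have mulint (w : 'rV[R]_d) : int_vec w -> int_vec (w *m KR).
  by move=> wint i; rewrite mxE rpred_sum // => l _; rewrite rpredM.
(* As [KR] kills [dl m0], the vector c z KR = v m0 KR is integral, and so is c eta KR. The choice of
   the bound on [eta] makes its entries smaller than 1, so it vanishes. *)
apply: int_vec_eq.
  rewrite subr0.
  rewrite (_ : c *: _ = j%:R *: (v m0 *m KR) - c *: ((j%:R *: z - eta) *m KR)).
    apply: int_vecB; apply: int_vecZ; [exact: rpred_nat| | |exact: mulint].
      exact: (mulint _ (vint m0)).
    by rewrite rpredB ?rpred_nat ?rpred1.
  have -> : v m0 *m KR = c *: (z *m KR).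
    rewrite /v mulmxBl (_ : dl m0 *m KR = 0); last first.
      have := dlMR _ Am0; rewrite submxE KRE -scalemxAr => /eqP ->.
      exact: scaler0.
    by rewrite subr0 scalemxAl /c scalerBl scale1r.
  rewrite mulmxBl -scalemxAl; apply/rowP => i; rewrite !mxE; ring.
move=> i; rewrite !mxE subr0 normrM (gtr0_norm c0).
apply: (@le_lt_trans _ _ (c * (B * `|eta|))).
  rewrite ler_pM2l// (le_trans (ler_norm_sum _ _ _))// /B mulr_suml.
  apply: ler_sum => l _; rewrite normrM mulrC ler_pM ?norm_coord_le//.
  by rewrite (bigD1 i) //= lerDl sumr_ge0.
rewrite mulrA; apply: (@le_lt_trans _ _ ((c * B + 1) * `|eta|)).
  by rewrite ler_wpM2r // lerDl.
by rewrite mulrC -ltr_pdivlMr ?div1r// ltr_wpDl// mulr_ge0 // ltW.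
Qed.

(** * Polynomials along the orbit *)

(* A finite-dimensional space of functions stable under [y |-> w + t *: y];
   the monomials of bounded degree in each variable are the intended model. *)
Record poly_family (R : realType) (d r : nat) := PolyFamily {
  pf_fun : 'I_r -> 'rV[R]_d -> R;
  pf_deg : 'I_r -> nat;
  pf_coef : 'I_r -> 'I_r -> 'I_r -> R;
  pf_add : forall i w t y, pf_fun i (w + t *: y) =
    \sum_j \sum_l pf_coef i j l * (pf_fun j w * t ^+ pf_deg l) * pf_fun l y;
  pf_cont : forall i, continuous (pf_fun i) }.

Definition pf_eval (R : realType) (d r : nat) (e : poly_family R d r)
  (c : 'rV[R]_r) (y : 'rV[R]_d) : R := \sum_i c ord0 i * pf_fun e i y.

(** The coefficients of y |-> f (w + t y), where [c] holds those of f. *)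
Definition pf_affine (R : realType) (d r : nat) (e : poly_family R d r)
    (w : 'rV[R]_d) (t : R) (c : 'rV[R]_r) : 'rV[R]_r :=
  \row_l \sum_i \sum_j c ord0 i * pf_coef e i j l * (pf_fun e j w * t ^+ pf_deg e l).

Lemma pf_affineE (R : realType) (d r : nat) (e : poly_family R d r)
    (w y : 'rV[R]_d) (t : R) (c : 'rV[R]_r) :
  pf_eval e (pf_affine e w t c) y = pf_eval e c (w + t *: y).
Proof.
rewrite /pf_eval; under [RHS]eq_bigr do rewrite pf_add mulr_sumr.
rewrite [RHS]exchange_big /=.
under eq_bigr do rewrite mxE mulr_suml.
rewrite exchange_big /= [RHS]exchange_big /=; apply: eq_bigr => i _.
under [RHS]eq_bigr do rewrite mulr_sumr.
rewrite [RHS]exchange_big /=; apply: eq_bigr => l _.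
rewrite mulr_suml; apply: eq_bigr => j _; ring.
Qed.

Lemma pf_evalD (R : realType) (d r : nat) (e : poly_family R d r)
    (a : R) (b c : 'rV[R]_r) (y : 'rV[R]_d) :
  pf_eval e (a *: b + c) y = a * pf_eval e b y + pf_eval e c y.
Proof.
rewrite /pf_eval mulr_sumr -big_split /=; apply: eq_bigr => i _.
by rewrite !mxE; ring.
Qed.

Lemma pf_eval_mulmx (R : realType) (d r m : nat) (e : poly_family R d r)
    (a : 'rV[R]_m) (M : 'M[R]_(m, r)) (y : 'rV[R]_d) :
  pf_eval e (a *m M) y = \sum_i a ord0 i * pf_eval e (row i M) y.
Proof.
rewrite /pf_eval; under eq_bigr do rewrite mxE mulr_suml.
rewrite exchange_big /=; apply: eq_bigr => i _.
by rewrite mulr_sumr; apply: eq_bigr => j _; rewrite !mxE mulrA.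
Qed.

Lemma pf_eval_continuous (R : realType) (d r : nat) (e : poly_family R d r)
    (c : 'rV[R]_r) : continuous (pf_eval e c).
Proof.
move=> y.
apply: (@cvg_rsum R _ _ (nbhs y) (index_enum _) xpredT
  (fun i y => c ord0 i * pf_fun e i y) (fun i => c ord0 i * pf_fun e i y)) => i.
by apply: cvgMl_tmp; exact: pf_cont.
Qed.

(** On a line the function is a polynomial in the parameter, of degree bounded independently of the
    line. *)
Lemma pf_eval_line_zero (R : realType) (d r : nat) (e : poly_family R d r)
    (c : 'rV[R]_r) : exists N : nat, forall (w y : 'rV[R]_d) (u : nat -> R),
  injective u -> (forall j, (j < N)%N -> pf_eval e c (w + u j *: y) = 0) ->
  forall s, pf_eval e c (w + s *: y) = 0.
Proof.
pose N := (\max_(l < r) pf_deg e l).+1; exists N => w y u uinj Hu.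
pose P : {poly R} := \sum_l (\sum_i \sum_j c ord0 i * pf_coef e i j l *
  pf_fun e j w * pf_fun e l y) *: 'X^(pf_deg e l).
have PE s : P.[s] = pf_eval e c (w + s *: y).
  rewrite -pf_affineE /pf_eval /P horner_sum; apply: eq_bigr => l _.
  rewrite hornerZ hornerXn mxE !mulr_suml; apply: eq_bigr => i _.
  rewrite !mulr_suml; apply: eq_bigr => j _; ring.
suff P0 : P = 0 by move=> s; rewrite -PE P0 horner0.
apply: (@roots_geq_poly_eq0 _ _ (mkseq u N)).
- by apply/allP => _ /mapP[j jN ->]; rewrite rootE PE Hu//; rewrite mem_iota in jN.
- by rewrite map_inj_uniq// iota_uniq.
- rewrite size_mkseq; apply: (leq_trans (size_sum _ _ _)).
  apply/bigmax_leqP => l _; apply: (leq_trans (size_scale_leq _ _)).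
  by rewrite size_polyXn ltnS leq_bigmax.
Qed.

(* The affine maps preserving the ideal of the polynomials that vanish along
   [ep] contain the expanding homotheties [y |-> dl m + k ^ m *: y]; a
   polynomial vanishing along the powers of a homothety vanishes along all the
   homotheties with the same center [c m], composing those gives the translations
   by [c m - c m'], and [c m'] tends to 0. *)
Lemma stabilizer_span (R : realType) (k d r : nat) (e : poly_family R d r)
    (p : set_system nat) (dl ep : nat -> 'rV[R]_d) :
  (2 <= k)%N -> UltraFilter p -> p `<=` filter_conv p p ->
  (forall N, p [set n | (N <= n)%N]) -> dl @ p --> (0 : 'rV[R]_d) ->
  scaling_cocycle p k dl ep ->
  exists2 T : 'M[R]_d, \forall m \near p, (dl m <= T)%MS &
    forall w t c, (w <= T)%MS -> (\forall n \near p, pf_eval e c (ep n) = 0) ->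
    \forall n \near p, pf_eval e c (w + t *: ep n) = 0.
Proof.
move=> k2 pU pidem ptail dl0 coc.
pose I c := \forall n \near p, pf_eval e c (ep n) = 0.
pose stab w t := forall c, I c -> \forall n \near p, pf_eval e c (w + t *: ep n) = 0.
have stabI w t c : stab w t -> I c -> I (pf_affine e w t c).
  by move=> st /st; apply: filterS => n; rewrite pf_affineE.
have stabM w t w' t' : stab w t -> stab w' t' -> stab (w + t *: w') (t * t').
  move=> s1 s2 c /(stabI _ _ _ s1)/s2; apply: filterS => n.
  by rewrite pf_affineE scalerDr scalerA addrA.
have stabE w t w' t' : stab w t -> w = w' -> t = t' -> stab w' t' by move=> ? <- <-.
(* Finitely many rows span the vanishing polynomials of the family, so a single set of [m] in [p]
   serves all of them. *)
have [M HM] : exists M : 'M[R]_r, forall c, I c <-> (c <= M)%MS.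
  apply: subspace_rowspace.
    apply: filterS filterT => n _; rewrite /pf_eval big1// => i _.
    by rewrite mxE mul0r.
  move=> a b c Ib Ic; apply: filterS (filterI Ib Ic) => n [hb hc].
  by rewrite pf_evalD hb hc mulr0 addr0.
have p1 : \forall m \near p, stab (dl m) (k ^ m)%:R.
  have rows : \forall m \near p, forall i : 'I_r,
      \forall n \near p, pf_eval e (row i M) (dl m + (k ^ m)%:R *: ep n) = 0.
    apply: filter_forall => i.
    have /pidem : I (row i M) by apply/HM; exact: row_sub.
    rewrite /filter_conv /=; apply: filterS => m Hm.
    by apply: filterS (filterI Hm (coc m)) => n [/= <- ->].
  apply: filterS rows => m Hm c /HM/submxP[a ->].
  apply: filterS (filter_forall _ Hm) => n Hn.
  by rewrite pf_eval_mulmx big1// => i _; rewrite Hn mulr0.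
pose A := [set m | stab (dl m) (k ^ m)%:R /\ (0 < m)%N].
have pA : p A by apply: filterI p1 (ptail 1%N).
(* The centre, that is the fixed point, of y |-> dl m + k^m y. *)
have [cen cenE] : exists cen : nat -> 'rV[R]_d,
  forall m, cen m = - ((k ^ m)%:R - 1)^-1 *: dl m by eexists.
have km_neq0 m : (0 < m)%N -> (k ^ m)%:R - 1 != 0 :> R.
  by move=> m0; rewrite subr_eq0 -[1]/(1%:R) eqr_nat -[X in _ != X](expn0 k)
    eqn_exp2l// -lt0n.
have dlcen m : (0 < m)%N -> dl m = (1 - (k ^ m)%:R) *: cen m.
  move=> m0; rewrite cenE scalerA mulrN -mulNr opprB mulfV ?scale1r//.
  exact: km_neq0.
have homothety m s : A m -> stab ((1 - s) *: cen m) s.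
  move=> [stm m0].
  have pow j : stab ((1 - (k ^ m)%:R ^+ j) *: cen m) ((k ^ m)%:R ^+ j).
    elim: j => [|j IH].
      rewrite expr0 subrr scale0r => c; apply: filterS => n.
      by rewrite scale1r add0r.
    apply: stabE (stabM _ _ _ _ IH stm) _ _; last by rewrite exprSr.
    by rewrite dlcen// scalerA -scalerDl; congr (_ *: _); rewrite exprSr; ring.
  move=> c Ic.
  have [N HN] := pf_eval_line_zero e c.
  have : \forall n \near p, forall j : 'I_N,
      pf_eval e c ((1 - (k ^ m)%:R ^+ j) *: cen m + (k ^ m)%:R ^+ j *: ep n) = 0.
    by apply: filter_forall => j; exact: pow.
  apply: filterS => n Hn.
  have lineE t : (1 - t) *: cen m + t *: ep n = cen m + t *: (ep n - cen m).
    by apply/rowP => i; rewrite !mxE; ring.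
  rewrite lineE; apply: (HN _ _ (fun j => (k ^ m)%:R ^+ j)).
    move=> i j /eqP; rewrite -!natrX eqr_nat -!expnM eqn_exp2l// eqn_pmul2l//.
    by move/eqP.
  by move=> j jN; rewrite -lineE; exact: (Hn (Ordinal jN)).
pose Tr v := forall tau : R, stab (tau *: v) 1.
have [T HT] : exists T : 'M[R]_d, forall v, Tr v <-> (v <= T)%MS.
  apply: subspace_rowspace.
    move=> tau c; apply: filterS => n.
    by rewrite scaler0 scale1r add0r.
  move=> a u v Tu Tv tau.
  apply: stabE (stabM _ _ _ _ (Tu (tau * a)) (Tv tau)) _ _; last by rewrite mulr1.
  by rewrite scale1r scalerDr scalerA.
have diffT m m' : A m -> A m' -> Tr (cen m - cen m').
  move=> Am Am'.
  (* Homotheties of ratios [s] and [s^-1] with different centres compose to a translation. With s =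
     1 - tau this misses tau = 1, which is reached below by two half steps. *)
  have step s : s != 0 -> stab ((1 - s) *: (cen m - cen m')) 1.
    move=> s0.
    apply: stabE (stabM _ _ _ _ (homothety m s Am) (homothety m' s^-1 Am')) _ _.
      by apply/rowP => i; rewrite !mxE; field.
    by rewrite mulfV.
  move=> tau; have [->|tau1] := eqVneq tau 1.
    have h : (1 / 2 : R) != 0 by rewrite mul1r invr_eq0 pnatr_eq0.
    apply: stabE (stabM _ _ _ _ (step _ h) (step _ h)) _ _; last by rewrite mulr1.
    by apply/rowP => i; rewrite !mxE; field.
  apply: stabE (step (1 - tau) _) _ _; rewrite ?subr_eq0 1?eq_sym//.
  by rewrite subKr.
have cenT m : A m -> (cen m <= T)%MS.
  move=> Am.
  have h : (fun m' => cen m - cen m') @ p --> cen m.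
    rewrite -[X in _ --> X]subr0; apply: cvgB; first exact: cvg_cst.
    rewrite (funext cenE).
    rewrite -[X in _ --> X](scaler0 _ (- 0)).
    apply: cvgZ; last exact: dl0.
    by apply: cvgN; exact: (@cvg_expn_inv R k p 1 filter_filter k2 ptail).
  apply: (cvg_rowspace _ h); apply: filterS pA => m' Am'.
  exact/HT/diffT.
exists T.
  apply: filterS pA => m Am; rewrite dlcen; last by case: Am.
  exact/scalemx_sub/cenT.
move=> w t c wT; have [m Am] := filter_ex pA.
(* The homothety of ratio [t] and centre [cen m], followed by the translation by w - (1 - t) cen
   m. *)
have st0 : stab w t.
  have := (HT _).2 (cenT _ Am) (- (1 - t)) => h1.
  have := (HT _).2 wT 1; rewrite scale1r => h2.
  have := stabM _ _ _ _ (stabM _ _ _ _ h2 h1) (homothety m t Am).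
  move=> h; apply: stabE h _ _; last by rewrite !mul1r.
  by apply/rowP => i; rewrite !mxE; ring.
exact: st0.
Qed.

(** * Signs and dominant terms along an ultrafilter *)

Lemma cvg_ge0_near (R : realType) (I : Type) (p : set_system I) (u : I -> R)
    (l : R) : ProperFilter p -> u @ p --> l -> (\forall n \near p, 0 <= u n) ->
  0 <= l.
Proof.
move=> pP ul u0; rewrite leNgt; apply/negP => l0.
have h : \forall n \near p, u n < 0 by exact: (cvgr_lt _ ul _ l0).
have [n [un un']] := filter_ex (filterI u0 h).
by move: un'; rewrite ltNge un.
Qed.

Lemma cvg_gt0_near (R : realType) (I : Type) (p : set_system I) (u : I -> R)
    (l : R) : Filter p -> u @ p --> l -> 0 < l -> \forall n \near p, 0 < u n.
Proof. by move=> pF ul; apply: cvgr_gt. Qed.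

Lemma ultra_ge0_neq0_gt0 (R : realType) (I : Type) (p : set_system I)
    (u : I -> R) : UltraFilter p -> (\forall n \near p, 0 <= u n) ->
  ~ (\forall n \near p, u n = 0) -> \forall n \near p, 0 < u n.
Proof.
move=> pU u0 un0; have [//|h] := in_ultra_setVsetC [set n | u n = 0] pU.
by apply: filterS (filterI u0 h) => n [/= h1 /eqP h2]; rewrite lt_neqAle eq_sym h2.
Qed.

(* Dividing by the coefficient that dominates along the ultrafilter gives a
   limit; if this limit vanishes identically, it expresses the dominant function
   through the others, which leaves fewer functions. *)
Lemma ultra_normalize (R : realType) (I Omega : Type) (J : finType)
    (p : set_system I) (f : J -> Omega -> R) (c : J -> I -> R) :
  UltraFilter p ->
  (\forall n \near p, exists om, \sum_j c j n * f j om != 0) ->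
  exists (M : I -> R) (la : J -> R),
  [/\ \forall n \near p, 0 < M n,
      exists om, \sum_j la j * f j om != 0 &
      forall om, (fun n => (\sum_j c j n * f j om) / M n) @ p -->
        \sum_j la j * f j om].
Proof.
have sumT (c' : J -> I -> R) n om :
    \sum_j c' j n * f j om = \sum_(j in [set: J]%SET) c' j n * f j om.
  by apply: eq_bigl => j; rewrite inE.
move=> pU c0.
have {c0} : \forall n \near p, exists om,
    \sum_(j in [set: J]%SET) c j n * f j om != 0.
  by apply: filterS c0 => n [om]; rewrite sumT => ?; exists om.
move: {2}#|_| (leqnn #|[set: J]%SET|) => s.
suff H : forall (B : {set J}) c', (#|B| <= s)%N ->
  (\forall n \near p, exists om, \sum_(j in B) c' j n * f j om != 0) ->
  exists (M : I -> R) (la : J -> R),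
  [/\ \forall n \near p, 0 < M n,
      exists om, \sum_j la j * f j om != 0 &
      forall om, (fun n => (\sum_(j in B) c' j n * f j om) / M n) @ p -->
        \sum_j la j * f j om].
  move=> hs /(H _ _ hs)[M [la [h1 h2 h3]]]; exists M, la; split => // om.
  by under eq_fun do rewrite sumT; exact: h3.
elim: s => [|s IH] B {}c Bs c0.
  exfalso; have [n [om]] := filter_ex c0.
  move: Bs; rewrite leqn0 cards_eq0 => /eqP ->.
  by rewrite big_set0 eqxx.
(* The index of a largest coefficient depends on [n], but takes finitely many values, so it is
   constant for p-many [n]. *)
have [js Hjs] : exists js, \forall n \near p, js \in B /\
    forall j, j \in B -> `|c j n| <= `|c js n|.
  apply: ultra_exists; apply: filterS c0 => n [om nz].
  have [j0 j0B] : exists j0, j0 \in B.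
    apply/set0Pn; apply: contraNneq nz => ->; by rewrite big_set0.
  have [js jsB jsmax] := arg_maxP (fun j => `|c j n|) j0B.
  by exists js; split => // j /jsmax.
have [_ [jsB _]] := filter_ex Hjs.
pose M n := `|c js n|.
have M0 : \forall n \near p, 0 < M n.
  apply: filterS (filterI c0 Hjs) => n [[om nz] [_ jsmax]].
  rewrite /M normr_gt0; apply: contraNneq nz => cjs0.
  apply/eqP; rewrite big1// => j /jsmax; rewrite cjs0 normr0 normr_le0.
  by move=> /eqP ->; rewrite mul0r.
have lim j : exists l : R,
    (j \in B -> (fun n => c j n / M n) @ p --> l) /\ (j \notin B -> l = 0).
  have [jB|jB] := boolP (j \in B); last by exists 0; split.
  have [|l _ hl] := ultra_compact_cvg (u := fun n => c j n / M n) pU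
    (@segment_compact R (-1) 1).
    apply: filterS (filterI M0 Hjs) => n [Mn [_ jsmax]].
    rewrite /= in_itv /= -ler_norml normrM normfV (gtr0_norm Mn).
    by rewrite ler_pdivrMr// mul1r; exact: jsmax.
  by exists l; split.
have [la Hla] := choice lim.
have lasum om : \sum_j la j * f j om = \sum_(j in B) la j * f j om.
  rewrite (bigID (mem B)) /= [X in _ + X]big1 ?addr0// => j jB.
  by rewrite (Hla j).2// mul0r.
have [nz|zero] := pselect (exists om, \sum_j la j * f j om != 0).
  exists M, la; split => // om; rewrite lasum.
  under eq_fun do rewrite mulr_suml.
  apply: (@cvg_trans _ ((fun n =>
    \sum_j (if j \in B then c j n / M n else 0) * f j om) @ p)).
    apply: near_eq_cvg; apply: filterS filterT => n _ /=.
    rewrite [RHS]big_mkcond; apply: eq_bigr => j _.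
    by case: ifP; [rewrite mulrAC|rewrite mul0r].
  rewrite -lasum.
  apply: (@cvg_rsum R _ _ p _ _
    (fun j n => (if j \in B then c j n / M n else 0) * f j om)) => j.
  apply: cvgMr_tmp.
  have [jB|jB] := boolP (j \in B); first exact: (Hla j).1.
  by rewrite (Hla j).2//; exact: cvg_cst.
have zero' om : \sum_(j in B) la j * f j om = 0.
  by apply/eqP; rewrite -lasum; apply/negPn/negP => h; apply: zero; exists om.
have lajs : la js != 0.
  apply/eqP => la0; have := (Hla js).1 jsB; rewrite la0 => /cvgr0Pnorm_lt/(_ 1 ltr01) h.
  have [n [Mn]] := filter_ex (filterI M0 h).
  rewrite normrM normfV (gtr0_norm Mn) /M mulfV ?ltxx//.
  by rewrite gt_eqF.
pose c' j n := c j n - c js n * (la js)^-1 * la j.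
have c'E n om : \sum_(j in B) c j n * f j om = \sum_(j in B :\ js) c' j n * f j om.
  transitivity (\sum_(j in B) c' j n * f j om).
    rewrite -[LHS](subr0) -[X in _ - X = _](mulr0 (c js n * (la js)^-1)).
    rewrite -[X in _ - _ * X = _](zero' om) mulr_sumr -sumrB.
    by apply: eq_bigr => j _; rewrite /c'; ring.
  rewrite (big_setD1 js)//= /c' mulfVK//.
  by rewrite subrr mul0r add0r.
have [||M' [la' [h1 h2 h3]]] := IH (B :\ js) c'.
- by rewrite -ltnS (leq_trans _ Bs)// (cardsD1 js B) jsB.
- by apply: filterS c0 => n [om nz]; exists om; rewrite -c'E.
exists M', la'; split => // om; under eq_fun do rewrite c'E.
exact: h3.
Qed.

(* For [n] along [p] the normalised functions [(w, t) |-> f (w + t *: ep n]) on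
   [W * R] tend to a nonzero polynomial [q]; as [t = k ^ m] grows, the sign of [q]
   is that of its leading coefficient in [t], a polynomial in [w] which is
   nonnegative, hence positive, along [dl]. *)
Lemma strict_positivity (R : realType) (k d r : nat) (e : poly_family R d r)
    (p : set_system nat) (dl ep : nat -> 'rV[R]_d) (W : 'M[R]_d) (c : 'rV[R]_r) :
  (2 <= k)%N -> UltraFilter p -> p `<=` filter_conv p p ->
  (forall N, p [set n | (N <= n)%N]) -> dl @ p --> (0 : 'rV[R]_d) ->
  scaling_cocycle p k dl dl -> scaling_cocycle p k dl ep ->
  (\forall m \near p, (dl m <= W)%MS) ->
  (forall c', (\forall m \near p, pf_eval e c' (dl m) = 0) ->
    forall w, (w <= W)%MS -> pf_eval e c' w = 0) ->
  (\forall n \near p, 0 < pf_eval e c (ep n)) ->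
  \forall m1 \near p, exists2 rho : R, 0 < rho & forall w, (w <= W)%MS ->
    `|w - dl m1| < rho -> forall l : nat, (0 < l)%N ->
    \forall m \near p, \forall n \near p,
      0 < pf_eval e c (w + l%:R *: dl m + (l%:R * (k ^ m)%:R) *: ep n).
Proof.
move=> k2 pU pidem ptail dl0 cocd coce dlW dense cpos.
pose Om := ({w : 'rV[R]_d | (w <= W)%MS} * R)%type.
pose f (jl : 'I_r * 'I_r) (om : Om) :=
  pf_fun e jl.1 (sval om.1) * om.2 ^+ pf_deg e jl.2.
pose cc (jl : 'I_r * 'I_r) n :=
  (\sum_i c ord0 i * pf_coef e i jl.1 jl.2) * pf_fun e jl.2 (ep n).
have hE n om : \sum_jl cc jl n * f jl om = pf_eval e c (sval om.1 + om.2 *: ep n).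
  rewrite -pf_affineE /pf_eval [RHS](eq_bigr (fun l => \sum_j cc (j, l) n * f (j, l) om)).
    by rewrite exchange_big pair_bigA; apply: eq_bigr => -[].
  move=> l _; rewrite mxE exchange_big /= mulr_suml; apply: eq_bigr => j _.
  rewrite /cc /f /= !mulr_suml; apply: eq_bigr => i _; ring.
have om0P : ((0 : 'rV[R]_d) <= W)%MS by exact: sub0mx.
have [M [la [Mpos [om1 qnz] qlim]]] : exists (M : nat -> R) (la : 'I_r * 'I_r -> R),
  [/\ \forall n \near p, 0 < M n,
      exists om, \sum_j la j * f j om != 0 &
      forall om, (fun n => (\sum_j cc j n * f j om) / M n) @ p -->
        \sum_j la j * f j om].
  apply: ultra_normalize; apply: filterS cpos => n cn.
  exists (exist _ 0 om0P, 1); rewrite hE /= scale1r add0r.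
  by rewrite gt_eqF.
pose q (w : 'rV[R]_d) (t : R) :=
  \sum_(jl : 'I_r * 'I_r) la jl * (pf_fun e jl.1 w * t ^+ pf_deg e jl.2).
have {}qlim w t : (w <= W)%MS ->
    (fun n => pf_eval e c (w + t *: ep n) / M n) @ p --> q w t.
  move=> wW; have := qlim (exist _ w wW, t).
  by under eq_fun do rewrite hE.
pose qc i : 'rV[R]_r := \row_j \sum_(l | pf_deg e l == i) la (j, l).
pose D := (\max_(l < r) pf_deg e l).+1.
have degD l : (pf_deg e l < D)%N by rewrite ltnS leq_bigmax.
have qE w t : q w t = \sum_(i < D) t ^+ i * pf_eval e (qc i) w.
  pose g j l := la (j, l) * (pf_fun e j w * t ^+ pf_deg e l).
  rewrite /q (eq_bigr (fun jl => g jl.1 jl.2)); last by case.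
  rewrite -(pair_bigA _ g) /= /g.
  under [RHS]eq_bigr do rewrite mulr_sumr.
  rewrite [RHS]exchange_big /=; apply: eq_bigr => j _.
  rewrite (partition_big (fun l => Ordinal (degD l)) xpredT)//=.
  apply: eq_bigr => i _; rewrite mxE mulr_suml mulr_sumr.
  rewrite (eq_bigl (fun l => pf_deg e l == i)) => [|l]; last by rewrite -val_eqE.
  by apply: eq_bigr => l /eqP ->; ring.
(* As [qc i] gives the coefficient of t^i in [q], the largest active exponent [D0] is the degree of
   [q] in [t] over [W]. *)
pose act i := `[< exists2 w, (w <= W)%MS & (i < D)%N /\ pf_eval e (qc i) w != 0 >].
have actex : exists i, act i.
  case: om1 qnz => -[w wW] t; rewrite -[X in X != _]/(q w t) qE => nz.
  apply: contrapT => /forallNP na; case/negP: nz; apply/eqP/big1 => i _.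
  have [->|ne] := eqVneq (pf_eval e (qc i) w) 0; first by rewrite mulr0.
  by case: (na i); apply/asboolP; exists w.
have actD i : act i -> (i <= D)%N by move=> /asboolP[w _ [/ltnW]].
case: (ex_maxnP actex actD) => D0 /asboolP[w1 w1W [D0D nz1]] D0max.
have qE' w t : (w <= W)%MS -> t != 0 ->
    q w t = t ^+ D0 * \sum_(i < D0.+1) t^-1 ^+ (D0 - i) * pf_eval e (qc i) w.
  move=> wW t0; rewrite qE mulr_sumr.
  rewrite (big_ord_widen D (fun i => t ^+ D0 * (t^-1 ^+ (D0 - i) * pf_eval e (qc i) w)))//.
  rewrite [LHS](bigID (fun i : 'I_D => (i < D0.+1)%N)) /= [X in _ + X]big1 ?addr0.
    apply: eq_bigr => i; rewrite ltnS => iD0; rewrite mulrA; congr (_ * _).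
    have -> : t ^+ D0 = t ^+ i * t ^+ (D0 - i) by rewrite -exprD subnKC.
    by rewrite exprVn mulfK// expf_neq0.
  move=> i; rewrite -leqNgt => D0i.
  have [->|ne] := eqVneq (pf_eval e (qc i) w) 0; first by rewrite mulr0.
  have : act i by apply/asboolP; exists w.
  by move=> /D0max; rewrite leqNgt D0i.
(* After division by t^D0, with t = a k^m, only the leading coefficient survives, and the
   displacement b dl m tends to 0. *)
have lim (w : 'rV[R]_d) (a b : R) : 0 < a ->
    (fun m => \sum_(i < D0.+1) (a * (k ^ m)%:R)^-1 ^+ (D0 - i) *
        pf_eval e (qc i) (w + b *: dl m)) @ p --> pf_eval e (qc D0) w.
  move=> a0.
  have -> : pf_eval e (qc D0) w =
      \sum_(i < D0.+1) (0 : R) ^+ (D0 - i) * pf_eval e (qc i) w.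
    rewrite big_ord_recr /= subnn expr0 mul1r big1 ?add0r// => i _.
    by rewrite expr0n subn_eq0 leqNgt ltn_ord mul0r.
  apply: (@cvg_rsum R _ _ p _ _
    (fun (i : 'I_D0.+1) m => (a * (k ^ m)%:R)^-1 ^+ (D0 - i) *
       pf_eval e (qc i) (w + b *: dl m))
    (fun i : 'I_D0.+1 => 0 ^+ (D0 - i) * pf_eval e (qc i) w)) => i.
  apply: cvgM.
    have inv0 : (fun m => (a * (k ^ m)%:R)^-1) @ p --> (0 : R).
      rewrite -(mulr0 a^-1); under eq_fun do rewrite invfM.
      apply: cvgMl_tmp.
      rewrite (_ : (fun m => _) = fun m => ((k ^ m)%:R - 0)^-1).
        exact: (@cvg_expn_inv R k p 0 filter_filter k2 ptail).
      by apply/funext => m; rewrite subr0.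
    exact: (@cvg_comp _ _ _ (fun m => (a * (k ^ m)%:R)^-1)
      (fun x : R => x ^+ (D0 - i)) _ _ _ inv0 (@exprn_continuous _ _ _)).
  have wb : (fun m => w + b *: dl m) @ p --> w.
    rewrite -[X in _ --> X]addr0; apply: cvgD; first exact: cvg_cst.
    by rewrite -(scaler0 _ b); apply: cvgZl_tmp.
  exact: (@cvg_comp _ _ _ (fun m => w + b *: dl m) (pf_eval e (qc i)) _ _ _ wb
    (@pf_eval_continuous _ _ _ _ _ _)).
have k0 m : 0 < (k ^ m)%:R :> R by rewrite ltr0n expn_gt0 (leq_trans _ k2).
have q_ge0 : \forall m \near p, 0 <= q (dl m) (k ^ m)%:R.
  move: cpos => /pidem; rewrite /filter_conv /= => h.
  apply: filterS (filterI h dlW) => m [hm mW].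
  apply: (cvg_ge0_near _ (qlim _ _ mW)).
  apply: filterS (filterI (filterI hm (coce m)) Mpos) => n [[/= h1 h2] h3].
  by rewrite -h2 divr_ge0// ltW.
(* Idempotency is used again: [q_ge0] at m1 + m, with dl (m1 + m) = dl m1 + k^m1 dl m, passes to the
   limit in m. *)
have top_ge0 : \forall m \near p, 0 <= pf_eval e (qc D0) (dl m).
  have both : \forall m \near p, 0 <= q (dl m) (k ^ m)%:R /\ (dl m <= W)%MS.
    exact: filterI.
  have := pidem _ both; rewrite /filter_conv /= => h.
  apply: filterS (filterI h dlW) => m1 [h1 m1W].
  apply: (cvg_ge0_near _ (lim (dl m1) (k ^ m1)%:R (k ^ m1)%:R (k0 m1))).
  apply: filterS (filterI (filterI h1 (cocd m1)) dlW) => m [[/= [h2 h3] h4] h5].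
  rewrite h4 in h2 h3; move: h2; rewrite expnD natrM qE' ?mulf_neq0 ?gt_eqF//.
  by rewrite pmulr_rge0// exprn_gt0// mulr_gt0.
have top_gt0 : \forall m \near p, 0 < pf_eval e (qc D0) (dl m).
  (* Vanishing along [dl] would force vanishing on [W], whereas the leading coefficient is nonzero
     at [w1]. *)
  apply: ultra_ge0_neq0_gt0 => // /dense/(_ _ w1W) h0.
  by rewrite h0 eqxx in nz1.
apply: filterS top_gt0 => m1 m1pos.
have : \forall w \near dl m1, 0 < pf_eval e (qc D0) w.
  exact: (cvgr_gt _ (@pf_eval_continuous _ _ _ e (qc D0) (dl m1)) _ m1pos).
move=> /nbhs_ballP[rho /= rho0 Hrho]; exists rho => // w wW wrho l l0.
have wpos : 0 < pf_eval e (qc D0) w.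
  by apply: Hrho; rewrite -ball_normE /= distrC.
have l0R : 0 < l%:R :> R by rewrite ltr0n.
have Gpos := cvg_gt0_near filter_filter (lim w l%:R l%:R l0R) wpos.
have GW : p [set m | 0 < \sum_(i < D0.+1) (l%:R * (k ^ m)%:R)^-1 ^+ (D0 - i) *
    pf_eval e (qc i) (w + l%:R *: dl m) /\ (dl m <= W)%MS].
  by apply: filterI; [exact: Gpos|exact: dlW].
apply: filterS GW => m [Gm mW].
have wlW : ((w + l%:R *: dl m)%R <= W)%MS by rewrite addmx_sub// scalemx_sub.
have qpos : 0 < q (w + l%:R *: dl m) (l%:R * (k ^ m)%:R).
  by rewrite qE' ?mulf_neq0 ?gt_eqF// mulr_gt0// exprn_gt0// mulr_gt0.
have hpos := cvg_gt0_near filter_filter (qlim _ (l%:R * (k ^ m)%:R) wlW) qpos.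
have hM : p [set n | 0 < pf_eval e c (w + l%:R *: dl m +
    (l%:R * (k ^ m)%:R) *: ep n) / M n /\ 0 < M n].
  by apply: filterI; [exact: hpos|exact: Mpos].
apply: filterS hM => n [h1 h2].
by move: h1; rewrite pmulr_lgt0// invr_gt0.
Qed.

(** * The monomials of bounded degree in each variable *)

Section Monomials.
Context (R : realType) (d N : nat).
Local Notation J := {ffun 'I_d -> 'I_N.+1}.

Definition monomial (a : J) (y : 'rV[R]_d) : R := \prod_i y ord0 i ^+ a i.

(** The binomial formula in each coordinate. The truncated subtraction is harmless: the binomial
    coefficient vanishes when b i > a i. *)
Lemma monomial_add (a : J) (w y : 'rV[R]_d) (t : R) :
  monomial a (w + t *: y) = \sum_(b : J)
    (\prod_i 'C(a i, b i)%:R) *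
    (monomial [ffun i => inord (a i - b i)] w * t ^+ (\sum_i b i)) * monomial b y.
Proof.
have expand i : (w + t *: y) ord0 i ^+ a i = \sum_(v < N.+1)
    'C(a i, v)%:R * (w ord0 i ^+ (a i - v) * t ^+ v) * y ord0 i ^+ v.
  rewrite !mxE exprDn.
  rewrite (big_ord_widen N.+1 (fun v => w ord0 i ^+ (a i - v) *
    (t * y ord0 i) ^+ v *+ 'C(a i, v)))//.
  rewrite big_mkcond; apply: eq_bigr => v _.
  case: ltnP => va; last by rewrite bin_small// !mul0r.
  by rewrite -mulr_natl exprMn; ring.
rewrite /monomial; under eq_bigr do rewrite expand.
rewrite bigA_distr_bigA /=; apply: eq_bigr => b _.
rewrite -prodrXr -!big_split /=; apply: eq_bigr => i _.
rewrite ffunE inordK//.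
by rewrite ltnS (leq_trans (leq_subr _ _))// -ltnS.
Qed.

Lemma monomial_continuous (a : J) : continuous (monomial a).
Proof.
move=> y.
apply: (@cvg_big _ _ _ _ xpredT _ _ (nbhs y) (index_enum _)
   (fun i (y : 'rV[R]_d) => y ord0 i ^+ a i)) => [|i _].
  exact: mul_continuous.
apply: (@cvg_comp _ _ _ (fun y : 'rV[R]_d => y ord0 i) (fun x : R => x ^+ a i) _ _ _
  (@coord_continuous R 1 d ord0 i y)).
exact: exprn_continuous.
Qed.

Lemma sum_multi_index (G : J -> R) :
  \sum_(b : J) G b = \sum_(j < #|J|) G (enum_val j).
Proof. by rewrite (reindex _ (onW_bij _ (@enum_val_bij J))). Qed.

Definition monomial_family : poly_family R d #|{: J}|.
Proof.
refine (@PolyFamily R d _ (fun j => monomial (enum_val j))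
  (fun j => \sum_i enum_val j i)%N
  (fun j1 j2 j3 =>
     (enum_val j2 == [ffun i => inord (enum_val j1 i - enum_val j3 i)] :> J)%:R *
     \prod_i 'C(enum_val j1 i, enum_val j3 i)%:R) _ _).
- move=> j1 w t y; rewrite monomial_add sum_multi_index exchange_big /=.
  apply: eq_bigr => j3 _.
  set b0 := [ffun i => _].
  rewrite (bigD1 (enum_rank b0))//= [X in _ + X]big1 ?addr0 => [|j2 j2b].
    by rewrite enum_rankK eqxx mul1r.
  rewrite (_ : _ == _ = false) ?mul0r//; apply: contraNF j2b => /eqP <-.
  by rewrite enum_valK.
- by move=> j; exact: monomial_continuous.
Defined.

Lemma pf_eval_monomial (a : J) (b : R) (c : 'rV[R]_#|{: J}|) (y : 'rV[R]_d) :
  pf_eval monomial_family (b *: delta_mx ord0 (enum_rank a) + c) y =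
  b * monomial a y + pf_eval monomial_family c y.
Proof.
rewrite pf_evalD; congr (_ * _ + _).
rewrite /pf_eval (bigD1 (enum_rank a))//= big1 ?addr0 => [|j ja].
  by rewrite mxE !eqxx mul1r enum_rankK.
by rewrite mxE (negbTE ja) andbF mul0r.
Qed.

Lemma pf_eval0 (y : 'rV[R]_d) : pf_eval monomial_family 0 y = 0.
Proof. by rewrite /pf_eval big1// => i _; rewrite mxE mul0r. Qed.

Lemma pf_eval_shift (g : 'rV[R]_d -> R) (z : 'rV[R]_d) :
  (exists c, forall y, pf_eval monomial_family c y = g y) ->
  exists c, forall y, pf_eval monomial_family c y = g (z + y).
Proof.
move=> [c Hc]; exists (pf_affine monomial_family z 1 c) => y.
by rewrite pf_affineE scale1r Hc.
Qed.

Lemma pf_eval_mpoly (f : mpoly.mpoly d R) :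
  (\max_(m <- mpoly.msupp f) mpoly.mdeg m <= N)%N ->
  exists c, forall y, pf_eval monomial_family c y = mpoly.meval (y ord0) f.
Proof.
move=> fN.
suff [c Hc] : exists c, forall y, pf_eval monomial_family c y =
    \sum_(m <- mpoly.msupp f)
      mpoly.mcoeff m f * \prod_i y ord0 i ^+ mpoly.fun_of_multinom m i.
  by exists c => y; rewrite Hc mpoly.mevalE.
elim: (mpoly.msupp f) fN => [_|m s IH].
  by exists 0 => y; rewrite big_nil pf_eval0.
rewrite big_cons geq_max => /andP[mN /IH[c Hc]].
pose a : J := [ffun i => inord (mpoly.fun_of_multinom m i)].
exists (mpoly.mcoeff m f *: delta_mx ord0 (enum_rank a) + c) => y.
rewrite pf_eval_monomial Hc big_cons; congr (_ * _ + _).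
apply: eq_bigr => i _; rewrite ffunE inordK// ltnS (leq_trans _ mN)//.
by rewrite mpoly.mdegE (bigD1 i)//= leq_addr.
Qed.

Lemma pf_eval_coord (a b : R) (i : 'I_d) : (0 < N)%N ->
  exists c, forall y, pf_eval monomial_family c y = a + b * y ord0 i.
Proof.
move=> N0; pose x1 : J := [ffun j => inord (j == i)].
exists (b *: delta_mx ord0 (enum_rank x1) +
  (a *: delta_mx ord0 (enum_rank [ffun=> ord0]) + 0)) => y.
rewrite !pf_eval_monomial pf_eval0 addr0 addrC; congr (_ + _ * _).
  by rewrite /monomial big1 ?mulr1// => j _; rewrite ffunE expr0.
rewrite /monomial (bigD1 i)//= big1 ?mulr1 => [|j /negbTE ji].
  by rewrite ffunE eqxx inordK ?expr1// ltnS.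
by rewrite ffunE ji inordK// expr0.
Qed.

End Monomials.

Lemma mdeg_bound (R : realType) (d : nat) (s : seq (mpoly.mpoly d R)) :
  exists N : nat, all (fun f => \max_(m <- mpoly.msupp f) mpoly.mdeg m <= N)%N s.
Proof.
elim: s => [|f s [N sN]]; first by exists 0%N.
exists (maxn (\max_(m <- mpoly.msupp f) mpoly.mdeg m) N); rewrite /= leq_maxl /=.
by apply: sub_all sN => g gN; rewrite leq_max gN orbT.
Qed.

(** * Multipliers *)

(* For [P] holding along [ep], and for the multiplier [l = k ^ m1 + j]: if [w]
   stands for [(l - 1) z] modulo [Z^d], then [P] holds at the representatives of
   [l k ^ (m + n) x - z]. *)
Definition persists (R : realType) (d k : nat) (p : set_system nat)
    (dl ep : nat -> 'rV[R]_d) (W : 'M[R]_d) (P : set 'rV[R]_d) : Prop :=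
  (\forall n \near p, P (ep n)) ->
  \forall m1 \near p, exists2 rho : R, 0 < rho & forall w, (w <= W)%MS ->
    `|w - dl m1| < rho -> forall l : nat, (0 < l)%N ->
    \forall m \near p, \forall n \near p,
      P (w + l%:R *: dl m + (l%:R * (k ^ m)%:R) *: ep n).

Lemma persistsI (R : realType) (d k : nat) (p : set_system nat)
    (dl ep : nat -> 'rV[R]_d) (W : 'M[R]_d) (P Q : set 'rV[R]_d) : Filter p ->
  persists k p dl ep W P -> persists k p dl ep W Q ->
  persists k p dl ep W (P `&` Q).
Proof.
move=> pF hP hQ PQ.
have hP' : \forall n \near p, P (ep n) by apply: filterS PQ => n [].
have hQ' : \forall n \near p, Q (ep n) by apply: filterS PQ => n [].
apply: (@filterS2 _ p _ _ _ _ _ (hP hP') (hQ hQ')) => m1 [r r0 Hr] [s s0 Hs].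
exists (Num.min r s); first by rewrite lt_min r0.
move=> w wW; rewrite lt_min => /andP[wr ws] l l0.
apply: (@filterS2 _ p _ _ _ _ _ (Hr w wW wr l l0) (Hs w wW ws l l0)) => m h1 h2.
exact: (@filterI _ p _ _ _ h1 h2).
Qed.

Lemma persists_all (R : realType) (d k : nat) (p : set_system nat)
    (dl ep : nat -> 'rV[R]_d) (W : 'M[R]_d) (T : Type) (a : pred T)
    (b : T -> 'rV[R]_d -> bool) (s : seq T) : Filter p ->
  all a s -> (forall t, a t -> persists k p dl ep W [set y | b t y]) ->
  persists k p dl ep W [set y | all (b^~ y) s].
Proof.
move=> pF; elim: s => [_ _|t s IH /= /andP[at_ as_] H].
  move=> _; apply: filterS filterT => m1 _; exists 1 => // w _ _ l _.
  by apply: filterS filterT => m _; apply: filterS filterT.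
have -> : [set y | b t y && all (b^~ y) s] =
    [set y | b t y] `&` [set y | all (b^~ y) s].
  by apply/seteqP; split => y /= /andP.
apply: persistsI; [exact: H|exact: IH].
Qed.

(** The ultrafilter decides between [g = 0] and [g > 0] along [ep]. This serves the closed faces of
    the half-open cube. *)
Lemma persists_ge0 (R : realType) (d k : nat) (p : set_system nat)
    (dl ep : nat -> 'rV[R]_d) (W : 'M[R]_d) (g : 'rV[R]_d -> R) : UltraFilter p ->
  persists k p dl ep W [set y | g y == 0] -> persists k p dl ep W [set y | 0 < g y] ->
  persists k p dl ep W [set y | 0 <= g y].
Proof.
move=> pU h0 h1 hg.
have sub (P : set 'rV[R]_d) : P `<=` [set y | 0 <= g y] -> persists k p dl ep W P ->
    (\forall n \near p, P (ep n)) ->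
    \forall m1 \near p, exists2 rho : R, 0 < rho & forall w, (w <= W)%MS ->
    `|w - dl m1| < rho -> forall l : nat, (0 < l)%N ->
    \forall m \near p, \forall n \near p,
      0 <= g (w + l%:R *: dl m + (l%:R * (k ^ m)%:R) *: ep n).
  move=> sP hP /hP; apply: filterS => m1 [rho rho0 H]; exists rho => // w wW wr l l0.
  apply: filterS (H w wW wr l l0) => m; apply: filterS => n; exact: sP.
have [z|nz] := pselect (\forall n \near p, g (ep n) == 0).
  by apply: (sub _ _ h0) z => y /= /eqP ->.
apply: (sub _ _ h1); first by move=> y /= /ltW.
apply: ultra_ge0_neq0_gt0 => // h; apply: nz.
by apply: filterS h => n ->.
Qed.

(** The space [W] is the span of the [dl m] that lie in two stabilizers: the one for vanishing along
    [ep] handles the equations, the one for vanishing along [dl] provides the density used for the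
    strict inequalities. *)
Lemma pf_persists (R : realType) (k d r : nat) (e : poly_family R d r)
    (p : set_system nat) (dl ep : nat -> 'rV[R]_d) :
  (2 <= k)%N -> UltraFilter p -> p `<=` filter_conv p p ->
  (forall N, p [set n | (N <= n)%N]) -> dl @ p --> (0 : 'rV[R]_d) ->
  scaling_cocycle p k dl dl -> scaling_cocycle p k dl ep ->
  exists (A : set nat) (W : 'M[R]_d),
  [/\ p A, forall m, A m -> (dl m <= W)%MS,
     forall M : 'M[R]_d, (forall m, A m -> (dl m <= M)%MS) -> (W <= M)%MS,
     forall c, persists k p dl ep W [set y | pf_eval e c y == 0] &
     forall c, persists k p dl ep W [set y | 0 < pf_eval e c y]].
Proof.
move=> k2 pU pidem ptail dl0 cocd coce.
have [T1 dlT1 stab1] := stabilizer_span e k2 pU pidem ptail dl0 coce.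
have [T2 dlT2 stab2] := stabilizer_span e k2 pU pidem ptail dl0 cocd.
pose A := [set m | (dl m <= T1)%MS /\ (dl m <= T2)%MS].
have pA : p A by apply: filterI.
have [W HW] : exists W : 'M[R]_d, forall v : 'rV[R]_d,
    (forall M : 'M[R]_d, (forall m, A m -> (dl m <= M)%MS) -> (v <= M)%MS) <->
    (v <= W)%MS.
  apply: subspace_rowspace => [M _|a u v hu hv M hM]; first exact: sub0mx.
  by rewrite addmx_sub// ?scalemx_sub// ?hu// hv.
have dlW m : A m -> (dl m <= W)%MS by move=> Am; apply/HW => M; exact.
have Wmin (M : 'M[R]_d) : (forall m, A m -> (dl m <= M)%MS) -> (W <= M)%MS.
  by move=> hM; apply/row_subP => i; apply: (HW _).2 hM; exact: row_sub.
have WT1 : (W <= T1)%MS by apply: Wmin => m [].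
have WT2 : (W <= T2)%MS by apply: Wmin => m [].
have dlW' : \forall m \near p, (dl m <= W)%MS by apply: filterS pA.
exists A, W; split => // c cep.
  apply: filterS filterT => m1 _; exists 1 => // w wW _ l _.
  apply: filterS dlW' => m mW.
  have wlT : ((w + l%:R *: dl m)%R <= T1)%MS.
    by apply: submx_trans WT1; rewrite addmx_sub// scalemx_sub.
  have cep0 : \forall n \near p, pf_eval e c (ep n) = 0.
    by apply: filterS cep => n /eqP.
  by apply: filterS (stab1 _ (l%:R * (k ^ m)%:R) _ wlT cep0) => n /= ->.
apply: (strict_positivity k2 pU pidem ptail dl0 cocd coce dlW' _ cep).
move=> c' c'0 w wW.
(* The polynomial also vanishes at w + dl n, which tends to [w]. *)
have h := stab2 w 1 c' (submx_trans wW WT2) c'0.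
have wdl : (fun n => w + 1 *: dl n) @ p --> w.
  rewrite -[X in _ --> X]addr0; apply: cvgD; first exact: cvg_cst.
  by rewrite -(scaler0 _ 1); apply: cvgZl_tmp.
have lim := @cvg_comp _ _ _ (fun n => w + 1 *: dl n) (pf_eval e c') _ _ _ wdl
  (@pf_eval_continuous _ _ _ e c' w).
apply: (@cvg_unique _ (@Rhausdorff _) _ _ _ _ lim).
apply: (@cvg_trans _ (cst 0 @ p)); last exact: cvg_cst.
by apply: near_eq_cvg; apply: filterS h => n /= ->.
Qed.

(* Two partial sums of the generators of an IP set have close multiples of [z]. *)
Lemma IP_small_multiple (R : realType) (d : nat) (z : 'rV[R]_d) (B : set nat)
    (e : R) : IP B -> 0 < e ->
  exists j : nat, [/\ B j, (0 < j)%N & exists2 eta : 'rV[R]_d,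
    int_vec (j%:R *: z - eta) & `|eta| < e].
Proof.
move=> [u u0 uB] e0.
pose s r := (\sum_(0 <= i < r) u i)%N.
pose v r := frac_vec ((s r)%:R *: z).
have Cco : compact [set v : 'rV[R]_d | forall i, `[0, 1]%classic (v ord0 i)].
  exact: (@rV_compact R d (fun=> `[0, 1]%classic) (fun=> @segment_compact R 0 1)).
(* Containing all tails, [p] allows two indices r < r' whose partial sums both give points close to
   the limit. *)
have [p [pU ptail]] := @ultraFilterLemma _ (\oo : set_system nat) _.
have [|a _ va] := ultra_compact_cvg (u := v) pU Cco.
  apply: filterS filterT => r _ i; rewrite /= in_itv /=.
  by have /andP[-> /ltW] := frac_vec_cube ((s r)%:R *: z) i.
have e2 : 0 < e / 2 by rewrite divr_gt0.
have near_a : \forall r \near p, `|a - v r| < e / 2.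
  by move/cvgrPdist_lt: va; exact.
have [r ar] := filter_ex near_a.
have pr : p [set n | (r < n)%N] by apply: ptail; exists r.+1.
have [r' [ar' rr']] := filter_ex (@filterI _ p _ _ _ near_a pr).
pose j := (\sum_(r <= i < r') u i)%N.
have sE : s r' = (s r + j)%N by rewrite /s /j -big_cat_nat// ltnW.
exists j; split.
- have -> : j = (\sum_(i <- seq_fset tt (index_iota r r')) u i)%N.
    apply: perm_big; apply: uniq_perm; rewrite ?fset_uniq ?iota_uniq// => i.
    by rewrite seq_fsetE.
  apply: uB; apply/eqP => /fsetP /(_ r).
  by rewrite seq_fsetE mem_index_iota leqnn rr' inE.
- by rewrite /j big_ltn// addn_gt0 u0.
exists (v r' - v r).
  rewrite (_ : _ - _ = ((s r')%:R *: z - v r') - ((s r)%:R *: z - v r)).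
    by apply: int_vecB; exact: frac_vecB.
  by apply/rowP => i; rewrite sE natrD !mxE; ring.
rewrite (_ : _ - _ = (a - v r) - (a - v r')); last first.
  by apply/rowP => i; rewrite !mxE; ring.
by rewrite (splitr e) (le_lt_trans (ler_normB _ _))// ltrD.
Qed.

Theorem theorem3p1 (R : realType) (k d : nat) (hk : (2 <= k)%N) (hd : (1 <= d)%N)
    (x : 'rV[R]_d) (S : set 'rV[R]_d)
    (hS : S `<=` unit_cube (R := R) (d := d)) (hSa : semialgebraic S)
    (hc : central R [set n : nat | (0 < n)%N /\ S (frac_vec ((k ^ n)%:R *: x))]) :
  IPstar_plus [set l : nat | (0 < l)%N /\
    infinite_set [set n : nat | (0 < n)%N /\
      S (frac_vec ((l * k ^ n)%:R *: x))]].
Proof.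
have [p [pU pidem pE ptail]] := central_idempotent hc.
have [z [dl [ep [[dl0 _] cocd coce xE zint]]]] := idempotent_expansion k x pU pidem.
have Sep : \forall n \near p, S (z + ep n).
  by apply: filterS pE => n [_]; rewrite xE.
have [M [fs [gs SE]]] := hSa.
have [j Sj] : exists j : 'I_M, \forall n \near p,
    basic_semialgebraic (fs j) (gs j) (z + ep n).
  apply: (ultra_exists pU); apply: filterS Sep => n.
  by rewrite SE => -[j _ ?]; exists j.
have [N0 /[!all_cat]/andP[fN gN]] := mdeg_bound (fs j ++ gs j).
(* The successor ensures that the coordinate functions belong to the family. *)
pose N := N0.+1.
have mpolyN (f : mpoly.mpoly d R) :
    (\max_(m <- mpoly.msupp f) mpoly.mdeg m <= N0)%N ->
    exists c, forall y, pf_eval (monomial_family R d N) c y =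
      mpoly.meval ((z + y) ord0) f.
  move=> fN0; apply: (@pf_eval_shift _ _ _ (fun v => mpoly.meval (v ord0) f)).
  exact/pf_eval_mpoly/leqW.
have coordN (a b : R) i : exists c, forall y,
    pf_eval (monomial_family R d N) c y = a + b * (z + y) ord0 i.
  exact: (@pf_eval_shift _ _ _ (fun v => a + b * v ord0 i)) (pf_eval_coord _ _ _ _).
have [A [W [pA dlW Wmin pers0 persp]]] :=
  pf_persists (monomial_family R d N) hk pU pidem ptail dl0 cocd coce.
(* The inequalities of the cube are included so that z + y is the fractional part of whatever it is
   congruent to. *)
pose P : set 'rV[R]_d :=
  [set y | all (fun f => mpoly.meval ((z + y) ord0) f == 0) (fs j)] `&`
  ([set y | all (fun g => 0 < mpoly.meval ((z + y) ord0) g) (gs j)] `&`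
  ([set y | all (fun i => 0 <= (z + y) ord0 i) (enum 'I_d)] `&`
  [set y | all (fun i => 0 < 1 - (z + y) ord0 i) (enum 'I_d)])).
have PS y : P y -> S (z + y) /\ unit_cube (z + y).
  move=> [/= h1 [h2 [h3 h4]]]; split.
    by rewrite SE; exists j => //; split.
  move=> i; move: (allP h3 i (mem_enum _ i)) (allP h4 i (mem_enum _ i)).
  by move=> -> /=; rewrite subr_gt0.
have Ppers : persists k p dl ep W P.
  apply: persistsI; last apply: persistsI; last apply: persistsI.
  - apply: (persists_all (b := fun f y => mpoly.meval ((z + y) ord0) f == 0)
      _ fN) => f.
    move=> /mpolyN[c cE]; have := pers0 c.
    by under eq_set do rewrite cE.
  - apply: (persists_all (b := fun f y => 0 < mpoly.meval ((z + y) ord0) f)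
      _ gN) => f.
    move=> /mpolyN[c cE]; have := persp c.
    by under eq_set do rewrite cE.
  - apply: (persists_all (a := xpredT) (b := fun i y => 0 <= (z + y) ord0 i)).
      exact/allP.
    move=> i _; have [c cE] := coordN 0 1 i; apply: persists_ge0.
      by have := pers0 c; under eq_set do rewrite cE add0r mul1r.
    by have := persp c; under eq_set do rewrite cE add0r mul1r.
  - apply: (persists_all (a := xpredT) (b := fun i y => 0 < 1 - (z + y) ord0 i)).
      exact/allP.
    move=> i _; have [c cE] := coordN 1 (-1) i.
    by have := persp c; under eq_set do rewrite cE mulN1r.
have Pep : \forall n \near p, P (ep n).
  apply: filterS (filterI Sep Sj) => n [/hS cub [h1 h2]].
  split => //; split => //; split; apply/allP => i _; have /andP[h3 h4] := cub i => //.
  by rewrite subr_gt0.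
have [m1 [[rho rho0 Hrho] Am1]] := filter_ex (filterI (Ppers Pep) pA).
have [e1 e10 He1] := small_multiple_in_span hk _ ptail pA dl0 zint dlW Wmin.
have e0 : 0 < Num.min rho e1 by rewrite lt_min rho0.
(* The multiplier is l = k^m1 + i with i z small modulo Z^d; translating by -k^m1 sends it to
   [i]. *)
exists (- (k ^ m1)%N%:Z) => B /(IP_small_multiple z)/(_ e0)[i [Bi i0 [eta etaint]]].
rewrite lt_min => /andP[eta_rho eta_e1].
exists i; split => //; split => //; exists (i + k ^ m1)%N; last by rewrite PoszD addrK.
set l := (i + k ^ m1)%N.
have l0 : (0 < l)%N by rewrite addn_gt0 i0.
split => //.
(* Modulo Z^d this is (l - 1) z = (k^m1 - 1) z + i z. *)
pose w := dl m1 + eta.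
have wW : (w <= W)%MS by rewrite addmx_sub ?dlW//; apply: He1 eta_e1.
have wrho : `|w - dl m1| < rho by rewrite /w addrAC subrr add0r.
have [m Hm] := filter_ex (Hrho w wW wrho l l0).
have Sl : \forall n \near p, S (frac_vec ((l * k ^ (m + n))%:R *: x)).
  apply: filterS Hm => n /PS; set y := (X in z + X) => -[Sy cy].
  rewrite (_ : frac_vec _ = z + y)//; apply: frac_vec_unique => //.
  have xint := frac_vecB ((k ^ n)%:R *: x); rewrite xE in xint.
  rewrite (_ : _ - _ = (l%:R * (k ^ m)%:R) *: ((k ^ n)%:R *: x - (z + ep n)) +
     (l%:R *: ((k ^ m)%:R *: z - z - dl m) +
     (((k ^ m1)%:R *: z - z - dl m1) + (i%:R *: z - eta)))); last first.
    by apply/rowP => q; rewrite /y /w !mxE /l expnD !natrM natrD; ring.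
  apply: int_vecD; first by apply: int_vecZ => //; rewrite rpredM ?rpred_nat.
  by apply: int_vecD; [apply: int_vecZ => //; exact: rpred_nat|exact: int_vecD].
move=> /finite_seqP[s sE].
(* An [n] beyond the maximum of the supposedly finite set makes m + n a new element of it. *)
have [n [Sn nbig]] := filter_ex (filterI Sl (ptail (\max_(q <- s) q).+1)).
have mns : (m + n)%N \in s.
  suff : [set` s] (m + n)%N by [].
  rewrite -sE; split => //.
  by rewrite addn_gt0 (leq_trans _ nbig)// orbT.
have := @leq_bigmax_seq _ s xpredT id _ mns isT.
by rewrite leqNgt (leq_trans nbig (leq_addl _ _)).
Qed.
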